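(* Let $V$ be a vertex operator algebra over $\mathbb{R}$ satisfying the standing assumptions described in the context, let $e,f$ be Ising vectors of $V$, let $T=\langle\tau_e,\tau_f\rangle\leq\mathrm{Aut}(V)$, and let $N=|e^T\cup f^T|$. \begin{enumerate} \item[(1)] If $N=2$, then $\langle e,f\rangle=0$ or $1/2^5$. \item[(2)] If $N=3$, then $\langle e,f\rangle=13/2^{10}$ or $1/2^8$. \item[(3)] If $N=4$, then $(\langle e,f\rangle,\langle e,e^{\tau_f}\rangle)=(1/2^7,0)$ or $(1/2^8,1/2^5)$. \item[(4)] If $N=5$, then $\langle e,f\rangle=\langle e,e^{\tau_f}\rangle=3/2^9$. \item[(5)] If $N=6$, then $\langle e,f\rangle=5/2^{10}$, $\langle e,e^{\tau_f}\rangle=13/2^{10}$ and $\langle e^{\tau_f},f^{\tau_e}\rangle=1/2^5$. \end{enumerate}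
   Context: Standing assumptions: $V=(V,Y,\mathbf{1},\omega)$ is a vertex operator algebra over $\mathbb{R}$, with $Y(v,z)=\sum_{n\in\mathbb{Z}}v_{(n)}z^{-n-1}$, graded as $V=\bigoplus_{n=0}^\infty V_n$ with $V_0=\mathbb{R}\mathbf{1}$ and $V_1=0$. Such a $V$ has a unique invariant bilinear form $\langle\cdot,\cdot\rangle$ with $\langle\mathbf{1},\mathbf{1}\rangle=1$, and it is assumed to be positive-definite. On $V_2$ the form satisfies $\langle x,y\rangle\mathbf{1}=x_{(3)}y$. Ising vectors: a vector $a\in V_2$ is a conformal vector with central charge $c$ if $a_{(1)}a=2a$ and $a_{(3)}a=\frac{c}{2}\mathbf{1}$. It is an Ising vector if $c=1/2$ and $a$ generates the simple Virasoro vertex operator algebra $L(1/2,0)$, which is rational with irreducible modules $L(1/2,0)$, $L(1/2,1/2)$, $L(1/2,1/16)$. For an Ising vector $a$ and $h\in\{0,1/2,1/16\}$, $V_a(h)$ is the sum of all submodules of $V$ isomorphic to $L(1/2,h)$ as modules over the Virasoro vertex operator algebra generated by $a$; one has $V=V_a(0)\oplus V_a(1/2)\oplus V_a(1/16)$. The $\tau$-involution $\tau_a$ is the automorphism of $V$ equal to $1$ on $V_a(0)\oplus V_a(1/2)$ and $-1$ on $V_a(1/16)$. Automorphisms act on the right: $x^\sigma$ is the image of $x$ under $\sigma$, and $x^{\sigma\sigma'}=(x^\sigma)^{\sigma'}$. For $x\in V$, $x^T$ denotes the orbit of $x$ under $T$. *)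

(* Defs.v *)
From HB Require Import structures.
From mathcomp Require Import all_boot all_order all_algebra.
From mathcomp Require Import all_classical all_reals all_analysis.

Set Implicit Arguments.
Unset Strict Implicit.
Unset Printing Implicit Defensive.

Import Order.TTheory GRing.Theory Num.Theory.

Local Open Scope classical_set_scope.
Local Open Scope ring_scope.

Definition binz (R : realType) (m : int) (i : nat) : R :=
  (\prod_(j < i) (m%:~R - j%:R)) / i`!%:R.

(* [vprod u n v] is u_(n) v, where Y(u,z) = \sum_n u_(n) z^(-n-1), so that
   L(n) = omega_(n+1).  The sums of the Jacobi identity have finitely many
   nonzero terms by [vprod_trunc]; the identity is therefore stated for all
   sufficiently long partial sums.
   [vgrading], [vgrading_fin] and [vgrading_low] say that V is the direct sum
   of the eigenspaces V_n of L(0), n in Z, with every V_n finite dimensional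
   and V_n = 0 for n << 0; the sum of eigenspaces is automatically direct. *)
Record voa (R : realType) := Voa {
  voa_sort :> lmodType R;
  vprod : voa_sort -> int -> voa_sort -> voa_sort;
  vac : voa_sort;
  vomega : voa_sort;
  vrank : R;
  vprod_linearl : forall n v, linear (fun u => vprod u n v);
  vprod_linearr : forall u n, linear (vprod u n);
  vprod_trunc : forall u v, exists N : int,
    forall n : int, N <= n -> vprod u n v = 0;
  vac_id : forall n v, vprod vac n v = if n == -1 then v else 0;
  vcreation : forall v, vprod v (-1) vac = v;
  vcreation_reg : forall v (n : int), 0 <= n -> vprod v n vac = 0;
  vjacobi : forall (l m n : int) u v w, \forall K \near \oo,
    \sum_(i < K) binz R m i *: vprod (vprod u (l + i%:Z) v) (m + n - i%:Z) w =
    \sum_(i < K) ((-1) ^+ i * binz R l i) *: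
      (vprod u (m + l - i%:Z) (vprod v (n + i%:Z) w)
       - (-1) ^ l *: vprod v (n + l - i%:Z) (vprod u (m + i%:Z) w));
  vvirasoro : forall (m n : int) v,
    vprod vomega (m + 1) (vprod vomega (n + 1) v)
    - vprod vomega (n + 1) (vprod vomega (m + 1) v) =
    (m - n)%:~R *: vprod vomega (m + n + 1) v
    + (if m + n == 0 then ((m ^+ 3 - m)%:~R / 12 * vrank) *: v else 0);
  vderivative : forall u (n : int) v,
    vprod (vprod vomega 0 u) n v = - n%:~R *: vprod u (n - 1) v;
  vgrading : forall v, exists s : seq voa_sort,
    (forall x, x \in s -> exists n : int, vprod vomega 1 x = n%:~R *: x)
    /\ v = \sum_(x <- s) x;
  vgrading_fin : forall n : int, exists s : seq voa_sort, forall v,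
    vprod vomega 1 v = n%:~R *: v ->
    exists k : nat -> R, v = \sum_(i < size s) k i *: s`_i;
  vgrading_low : exists N : int, forall (n : int) v, n < N ->
    vprod vomega 1 v = n%:~R *: v -> v = 0
}.

Arguments vac {R} _.
Arguments vomega {R} _.
Arguments vprod {R} {_}.

Section VOA.
Variables (R : realType) (V : voa R).
Implicit Types (a u v w x y : V) (U W : set V) (g t : V -> V).

Definition homog (n : int) : set V :=
  [set v | vprod (vomega V) 1 v = n%:~R *: v].

(* V = \bigoplus_(n >= 0) V_n with V_0 = R 1 and V_1 = 0. *)
Definition standing_grading : Prop :=
  [/\ forall n : int, n < 0 -> homog n = [set 0],
      homog 0 = [set k *: vac V | k in [set: R]] &
      homog 1 = [set 0]].

(* Coefficientwise form of
     <Y(a,z)b, c> = <b, Y(e^(zL(1)) (-z^-2)^L(0) a, z^-1) c>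
   for a homogeneous of weight k; the sum over i has finitely many nonzero
   terms because L(1)^i a has weight k - i. *)
Definition invariant_form (B : V -> V -> R) : Prop :=
  [/\ forall y, scalar (B^~ y),
      forall x, scalar (B x) &
      forall (k n : int) a b c, homog k a -> \forall K \near \oo,
        B (vprod a n b) c =
        (-1) ^ k * \sum_(i < K) (i`!%:R)^-1 *
          B b (vprod (iter i (vprod (vomega V) 2) a)
                     (2 * k - n - i%:Z - 2) c)].

Definition positive_definite (B : V -> V -> R) : Prop :=
  forall x, x != 0 -> 0 < B x x.

Definition subspace W : Prop :=
  W 0 /\ forall (k : R) x y, W x -> W y -> W (k *: x + y).

Definition vsubalgebra U : Prop :=
  [/\ subspace U, U (vac V) &
      forall u (n : int) v, U u -> U v -> U (vprod u n v)].

Definition vgenerated (A : set V) : set V := smallest vsubalgebra A.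

(* W is stable under the modes of the elements of the subalgebra U. *)
Definition vsubmodule U W : Prop :=
  subspace W /\ forall u (n : int) w, U u -> W w -> W (vprod u n w).

Definition virreducible U W : Prop :=
  [/\ vsubmodule U W, W <> [set 0] &
      forall W', vsubmodule U W' -> W' `<=` W -> W' = [set 0] \/ W' = W].

Definition vsimple U : Prop := vsubalgebra U /\ virreducible U U.

Definition conformal_vector (c : R) a : Prop :=
  [/\ homog 2 a, vprod a 1 a = 2 *: a & vprod a 3 a = (c / 2) *: vac V].

(* The Virasoro vertex operator algebra L(1/2,0) is the simple one generated
   by a conformal vector of central charge 1/2. *)
Definition ising_vector a : Prop :=
  conformal_vector (1 / 2) a /\ vsimple (vgenerated [set a]).

(* W is, over the Virasoro vertex operator algebra generated by a, isomorphic
   to L(c,h) (c the central charge of a), which is by definition the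
   irreducible module generated by a highest weight vector of weight h for
   the operators L^a(n) = a_(n+1). *)
Definition iso_L a (h : R) W : Prop :=
  virreducible (vgenerated [set a]) W /\
  exists v, [/\ W v, v != 0, vprod a 1 v = h *: v &
                forall n : int, 0 < n -> vprod a (n + 1) v = 0].

(* V_a(h), the sum of all submodules isomorphic to L(1/2,h). *)
Definition isotypic a (h : R) : set V :=
  [set x | exists s : seq V,
     (forall y, y \in s -> exists2 W, iso_L a h W & W y)
     /\ x = \sum_(y <- s) y].

Definition automorphism g : Prop :=
  [/\ linear g, bijective g, g (vac V) = vac V, g (vomega V) = vomega V &
      forall u (n : int) v, g (vprod u n v) = vprod (g u) n (g v)].

(* These properties determine tau_a, because V is the direct sum of V_a(0),
   V_a(1/2) and V_a(1/16). *)
Definition is_tau a t : Prop :=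
  [/\ automorphism t,
      forall x, isotypic a 0 x -> t x = x,
      forall x, isotypic a (1 / 2) x -> t x = x &
      forall x, isotypic a (1 / 16) x -> t x = - x].

Inductive group_generated (S : set (V -> V)) : set (V -> V) :=
| Gen_mem g : S g -> group_generated S g
| Gen_id : group_generated S id
| Gen_comp g t : group_generated S g -> group_generated S t ->
    group_generated S (g \o t)
| Gen_inv g t : group_generated S g -> cancel g t -> cancel t g ->
    group_generated S t.

(* x^T; for sigma acting on the right, x^sigma is the value [g x]. *)
Definition orbit_of (T : set (V -> V)) x : set V := [set g x | g in T].

End VOA.

(* Main.v *)
(* Let P be the orthogonal complement of an Ising vector e in V_2, and write e.x
   for e_(1)x.  The singular vector of weight 6 of the vacuum module of central
   charge 1/2 has norm zero, so it vanishes; its zero mode shows that the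
   eigenvalues of e on P are 0, 1/2 and 1/16.  An eigenvector generates an
   irreducible module over the subalgebra of e, so tau_e is determined on V_2 by
   this eigenspace decomposition.  The singular vectors of weight 1 (h = 0) and
   5/2 (h = 1/2) give the fusion rules 0.h in h and 1/2.1/2 in 0 + Re.

   For two axes a, b put a_0 = a, a_1 = b and let a_(2i-j) be the image of a_j
   under tau of a_i.  The vector s = a.b - (a + b)/16 is invariant under the
   dihedral group, and the fusion rules at a express s.s through s, two
   analogous vectors and a_(-2), ..., a_2.  Comparing with the expression
   centred at b gives a linear relation between these vectors; its inner
   products with the a_i are polynomial relations between the numbers
   (a_i, a_j), which determine them once the period of the sequence is known. *)

Require Import Defs.
From HB Require Import structures.
From mathcomp Require Import all_boot all_order all_algebra.
From mathcomp Require Import all_classical all_reals all_analysis.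
From mathcomp Require Import ring lra zify.

Set Implicit Arguments.
Unset Strict Implicit.
Unset Printing Implicit Defensive.

Import Order.TTheory GRing.Theory Num.Theory.

Local Open Scope classical_set_scope.
Local Open Scope ring_scope.

(** * Modes of a vertex operator algebra *)

(** Because V_1 = 0, the adjoint of x_(n) for x in V_2 is x_(2-n). A vector killed by the raising
    modes of e is therefore orthogonal to everything the lowering modes produce, and positivity
    makes singular vectors vanish; the same adjointness gives irreducibility of highest weight
    modules.

    The involution tau_a is prescribed on all of V, but on V_2 it is a polynomial in a_(1). Only
    this polynomial, and the fact that it extends to an automorphism, are retained: every
    automorphism transports both from a to its image.

    The reflections preserve the parity of the index, so symmetry alone does not identify (a_0, a_2)
    with (a_1, a_3), nor (a_0, a_4) with (a_1, a_5). Both equalities come out of the algebra, and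
    they also exclude, for small periods, sequences whose even and odd terms have different
    periods. *)

Lemma addP0 (m : int) : m + 0%N%:Z = m. Proof. exact: addr0. Qed.

Lemma subP0 (m : int) : m - 0%N%:Z = m. Proof. exact: subr0. Qed.

Lemma signrN1 (F : fieldType) : (-1) ^ (-1) = -1 :> F.
Proof. by rewrite exprN1 invrN1. Qed.

Section LinearFun.
Variables (R : pzRingType) (U W : lmodType R) (g : U -> W).
Hypothesis glin : linear g.

Lemma linear_funD x y : g (x + y) = g x + g y.
Proof. by have := glin 1 x y; rewrite !scale1r. Qed.

Lemma linear_fun0 : g 0 = 0.
Proof. by apply: (addrI (g 0)); rewrite -linear_funD !addr0. Qed.

Lemma linear_funZ k x : g (k *: x) = k *: g x.
Proof. by have := glin k x 0; rewrite linear_fun0 !addr0. Qed.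

Lemma linear_funN x : g (- x) = - g x.
Proof. by rewrite -scaleN1r linear_funZ scaleN1r. Qed.

End LinearFun.

Section Modes.
Variables (R : realType) (V : voa R).
Implicit Types (u v w x : V) (k : R) (m n l : int).

Lemma vprodDl n u v w : vprod (u + v) n w = vprod u n w + vprod v n w.
Proof. exact: (linear_funD (vprod_linearl n w)). Qed.

Lemma vprodDr n u v w : vprod u n (v + w) = vprod u n v + vprod u n w.
Proof. exact: (linear_funD (vprod_linearr u n)). Qed.

Lemma vprod0l n v : vprod 0 n v = 0.
Proof. exact: (linear_fun0 (vprod_linearl n v)). Qed.

Lemma vprod0r u n : vprod u n 0 = 0.
Proof. exact: (linear_fun0 (vprod_linearr u n)). Qed.

Lemma vprodZl n k u v : vprod (k *: u) n v = k *: vprod u n v.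
Proof. exact: (linear_funZ (vprod_linearl n v)). Qed.

Lemma vprodZr n k u v : vprod u n (k *: v) = k *: vprod u n v.
Proof. exact: (linear_funZ (vprod_linearr u n)). Qed.

Lemma vprodNl n u v : vprod (- u) n v = - vprod u n v.
Proof. exact: (linear_funN (vprod_linearl n v)). Qed.

Lemma vprodNr n u v : vprod u n (- v) = - vprod u n v.
Proof. exact: (linear_funN (vprod_linearr u n)). Qed.

Definition vprodE := (vprodDl, vprodDr, vprodNl, vprodNr, vprodZl, vprodZr,
  vprod0l, vprod0r).

Lemma binz0 m : binz R m 0 = 1.
Proof. by rewrite /binz big_ord0 fact0 divr1. Qed.

Lemma binzS m i : binz R m i.+1 = binz R m i * (m%:~R - i%:R) / i.+1%:R.
Proof.
rewrite /binz big_ord_recr /= factS natrM invfM; ring.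
Qed.

Lemma binz_nat_small (m i : nat) : (m < i)%N -> binz R m i = 0.
Proof.
elim: i => // i IH; rewrite ltnS leq_eqVlt binzS => /orP[/eqP->|/IH->].
  by rewrite pmulrn subrr mulr0 mul0r.
by rewrite !mul0r.
Qed.

(** Turns the eventual equality of partial sums in [vjacobi] into an equality at one explicit
    length, past which both families vanish. *)
Lemma near_sum_trunc {U : lmodType R} (F G : nat -> U) (K : nat) :
  (forall i, (K <= i)%N -> F i = 0) -> (forall i, (K <= i)%N -> G i = 0) ->
  (\forall K' \near \oo, \sum_(i < K') F i = \sum_(i < K') G i) ->
  \sum_(i < K) F i = \sum_(i < K) G i.
Proof.
move=> F0 G0 [N _ HN].
have cut H : (forall i, (K <= i)%N -> H i = 0) ->
    \sum_(i < maxn K N) H i = \sum_(i < K) H i :> U.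
  move=> H0; rewrite -!(big_mkord xpredT) (big_cat_nat (leq0n K) (leq_maxl _ _)) /=.
  rewrite [X in _ + X]big_nat_cond [X in _ + X]big1 ?addr0// => i.
  by rewrite andbT => /andP[/H0].
by rewrite -(cut F)// -(cut G)//; apply: HN; rewrite /= leq_maxr.
Qed.

(** The case l = 0 of [vjacobi]: the binomials of 0 leave a single commutator on the right. *)
Lemma vcommutator (K : nat) m n u v w :
  (forall i : nat, (K < i)%N ->
     binz R m i *: vprod (vprod u i v) (m + n - i%:Z) w = 0) ->
  vprod u m (vprod v n w) - vprod v n (vprod u m w) =
  \sum_(i < K.+1) binz R m i *: vprod (vprod u i v) (m + n - i%:Z) w.
Proof.
move=> HK; pose F i := binz R m i *: vprod (vprod u (0 + i%:Z) v) (m + n - i%:Z) w.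
pose G i := ((-1) ^+ i * binz R 0 i) *: (vprod u (m + 0 - i%:Z)
   (vprod v (n + i%:Z) w) - (-1) ^ 0 *: vprod v (n + 0 - i%:Z) (vprod u (m + i%:Z) w)).
have : \sum_(i < K.+1) F i = \sum_(i < K.+1) G i.
  apply: (@near_sum_trunc _ F G) => [i Ki|i Ki|].
  - by rewrite /F add0r HK.
  - by rewrite /G binz_nat_small ?mulr0 ?scale0r//; apply: leq_ltn_trans Ki.
  - exact: (@vjacobi R V 0 m n u v w).
rewrite [X in _ = X]big_ord_recl [X in _ + X]big1 => [|i _]; last first.
  by rewrite /G binz_nat_small ?mulr0 ?scale0r.
rewrite /F /G /= binz0 !mulr1 expr0 scale1r.
rewrite ?subP0 ?addP0 ?addr0 expr0z scale1r => <-.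
by apply: eq_bigr => i _; rewrite add0r.
Qed.

(** The case m = 0 of [vjacobi]: now the left side is a single term. *)
Lemma vassociator (K : nat) l n u v w :
  (forall i : nat, (K < i)%N -> vprod u i w = 0) ->
  (forall i : nat, (K < i)%N -> vprod v (n + i%:Z) w = 0) ->
  vprod (vprod u l v) n w =
  \sum_(i < K.+1) ((-1) ^+ i * binz R l i) *:
    (vprod u (l - i%:Z) (vprod v (n + i%:Z) w)
     - (-1) ^ l *: vprod v (n + l - i%:Z) (vprod u i w)).
Proof.
move=> HK HK'; pose F i := binz R 0 i *: vprod (vprod u (l + i%:Z) v) (0 + n - i%:Z) w.
pose G i := ((-1) ^+ i * binz R l i) *: (vprod u (0 + l - i%:Z)
   (vprod v (n + i%:Z) w) - (-1) ^ l *: vprod v (n + l - i%:Z) (vprod u (0 + i%:Z) w)).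
have : \sum_(i < K.+1) F i = \sum_(i < K.+1) G i.
  apply: (@near_sum_trunc _ F G) => [i Ki|i Ki|].
  - by rewrite /F binz_nat_small ?scale0r//; apply: leq_ltn_trans Ki.
  - by rewrite /G add0r HK' // add0r HK// !vprod0r scaler0 subr0 scaler0.
  - exact: (@vjacobi R V l 0 n u v w).
rewrite [X in X = _]big_ord_recl [X in _ + X]big1 => [|i _]; last first.
  by rewrite /F binz_nat_small ?scale0r.
rewrite /F /G /= binz0 scale1r !add0r ?subP0 ?addr0 => ->.
by apply: eq_bigr => i _; rewrite !add0r.
Qed.

Lemma vassociator3 l n (c : R) u v w :
  (forall i : int, 2 < i -> vprod u i w = 0) ->
  (forall i : int, n < i -> vprod v i w = 0) -> (-1) ^ l = c ->
  vprod (vprod u l v) n w = vprod u l (vprod v n w)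
  - c *: vprod v (n + l) (vprod u 0 w)
  + (c * l%:~R) *: vprod v (n + l - 1) (vprod u 1 w)
  - (c * (l * (l - 1))%:~R / 2) *: vprod v (n + l - 2) (vprod u 2 w).
Proof.
move=> u0 v0 <-; rewrite (@vassociator 2%N) => [|i i2|i i2]; last 2 first.
- exact: u0.
- by apply: v0; lia.
rewrite !big_ord_recr big_ord0 /= add0r ?addP0 (v0 (n + 1%N%:Z)); last by lia.
rewrite (v0 (n + 2%N%:Z)); last by lia.
rewrite !vprod0r !sub0r ?subP0 !binzS !binz0 !(intrM, intrD, intrN) /=.
have auxN k (x : V) : - (k *: x) = - k *: x by rewrite scaleNr.
have auxA a k (x : V) : a *: (k *: x) = (a * k) *: x by rewrite scalerA.
rewrite !auxN !auxA expr0 mul1r scale1r.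
by congr (_ + _ *: _ + _ *: _ + _ *: _); field.
Qed.

Lemma vassociator3_vanish l n (c : R) u v w :
  (forall i : int, 2 < i -> vprod u i w = 0) ->
  (forall i : int, n <= i -> vprod v i w = 0) -> (-1) ^ l = c ->
  vprod (vprod u l v) n w =
  - c *: vprod v (n + l) (vprod u 0 w)
  + (c * l%:~R) *: vprod v (n + l - 1) (vprod u 1 w)
  - (c * (l * (l - 1))%:~R / 2) *: vprod v (n + l - 2) (vprod u 2 w).
Proof.
move=> u0 v0 lc; rewrite (vassociator3 u0 _ lc) => [|i /ltW]; last exact: v0.
by rewrite v0// vprod0r add0r scaleNr.
Qed.

(* [vjacobi] with m = -1, n = 0 acting on the vacuum. *)
Lemma vskew (K : nat) l u v :
  (forall i : nat, (K < i)%N -> vprod u (l + i%:Z) v = 0) ->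
  vprod v l u = - (-1) ^ l *:
    \sum_(i < K.+1) binz R (-1) i *: vprod (vprod u (l + i%:Z) v) (- 1 - i%:Z) (vac V).
Proof.
move=> HK; pose F i := binz R (-1) i *: vprod (vprod u (l + i%:Z) v) (- 1 + 0 - i%:Z) (vac V).
pose G i := ((-1) ^+ i * binz R l i) *: (vprod u (- 1 + l - i%:Z)
   (vprod v (0 + i%:Z) (vac V)) - (-1) ^ l *: vprod v (0 + l - i%:Z) (vprod u (- 1 + i%:Z) (vac V))).
have G0 i : (0 < i)%N -> G i = 0.
  move=> i0; rewrite /G (_ : - 1 + i%:Z = i.-1); last by lia.
  by rewrite !vcreation_reg// !vprod0r scaler0 subr0 scaler0.
have : \sum_(i < K.+1) F i = \sum_(i < K.+1) G i.
  apply: (@near_sum_trunc _ F G) => [i Ki|i Ki|].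
  - by rewrite /F HK// vprod0l scaler0.
  - by rewrite G0//; apply: leq_ltn_trans Ki.
  - exact: (@vjacobi R V l (-1) 0 u v (vac V)).
rewrite [X in _ = X]big_ord_recl [X in _ + X]big1 => [|i _]; last by rewrite G0.
rewrite /F /G /= binz0 mulr1 expr0 scale1r ?addP0 ?subP0 ?addr0 ?add0r => ->.
rewrite (@vcreation_reg _ _ v 0)// vprod0r sub0r vcreation.
by rewrite scaleNr scalerN opprK scalerA -expfzMl mulrNN mulr1 exp1rz scale1r.
Qed.

End Modes.

(** * The Griess algebra and its conformal vectors *)

Section Grading.
Variables (R : realType) (V : voa R).
Implicit Types (u v w x y : V) (k : R) (m n : int).

Lemma vomega_comm m u n v :
  (forall i : nat, (1 < i)%N -> binz R m i = 0) ->
  vprod (vomega V) m (vprod u n v) - vprod u n (vprod (vomega V) m v) =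
  - (m + n)%:~R *: vprod u (m + n - 1) v
  + m%:~R *: vprod (vprod (vomega V) 1 u) (m + n - 1) v.
Proof.
move=> m0; rewrite (@vcommutator _ _ 1%N) => [|i i1]; last by rewrite m0 ?scale0r.
rewrite big_ord_recr big_ord_recr big_ord0 /= add0r binz0 scale1r ?subP0.
by rewrite vderivative binzS binz0 mul1r subr0 divr1.
Qed.

Lemma homog_vomega : homog (2 : int) (vomega V).
Proof.
rewrite /homog /=; have := vvirasoro 0 (-2) (vac V).
rewrite !add0r (_ : -2 + 1 = - 1 :> int)// !vcreation opprK.
by rewrite (vcreation_reg _ (n:=1))// vprod0r subr0 addr0.
Qed.

Lemma homog_vprod (k l n : int) u v :
  homog k u -> homog l v -> homog (k + l - n - 1) (vprod u n v).
Proof.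
rewrite /homog /= => hu hv; have := @vomega_comm 1 u n v.
move=> /(_ (fun i i1 => @binz_nat_small R 1 i i1)) /eqP.
rewrite subr_eq hu hv !vprodE (_ : 1 + n - 1 = n); last by lia.
rewrite scale1r -!scalerDl => /eqP ->; congr (_ *: _).
by rewrite !intrD !intrN; ring.
Qed.

Lemma homogD n u v : homog n u -> homog n v -> homog n (u + v).
Proof. by rewrite /homog /= => hu hv; rewrite vprodDr hu hv scalerDr. Qed.

Lemma homogZ n k u : homog n u -> homog n (k *: u).
Proof. by rewrite /homog /= => hu; rewrite vprodZr hu !scalerA mulrC. Qed.

Lemma homogN n u : homog n u -> homog n (- u).
Proof. by rewrite -scaleN1r; apply: homogZ. Qed.

Lemma homogB n u v : homog n u -> homog n v -> homog n (u - v).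
Proof. by move=> hu hv; apply: homogD => //; apply: homogN. Qed.

End Grading.

Section Griess.
Variables (R : realType) (V : voa R) (B : V -> V -> R).
Hypotheses (HV : standing_grading V) (HB : invariant_form B).
Hypotheses (HB1 : B (vac V) (vac V) = 1) (HBpos : positive_definite B).
Implicit Types (u v w x y : V) (k : R) (m n : int).

Let G : set V := homog 2.

Lemma formDl u v w : B (u + v) w = B u w + B v w.
Proof. by case: HB => /(_ w 1 u v) H _ _; rewrite -{1}(scale1r u) H mul1r. Qed.

Lemma formDr u v w : B u (v + w) = B u v + B u w.
Proof. by case: HB => _ /(_ u 1 v w) H _; rewrite -{1}(scale1r v) H mul1r. Qed.

Lemma form0l v : B 0 v = 0.
Proof. by apply: (addrI (B 0 v)); rewrite -formDl !addr0. Qed.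

Lemma form0r v : B v 0 = 0.
Proof. by apply: (addrI (B v 0)); rewrite -formDr !addr0. Qed.

Lemma formZl k u v : B (k *: u) v = k * B u v.
Proof. by case: HB => /(_ v k u 0) H _ _; rewrite -{1}(addr0 (k *: u)) H form0l addr0. Qed.

Lemma formZr k u v : B u (k *: v) = k * B u v.
Proof. by case: HB => _ /(_ u k v 0) H _; rewrite -{1}(addr0 (k *: v)) H form0r addr0. Qed.

Lemma formNl u v : B (- u) v = - B u v.
Proof. by rewrite -scaleN1r formZl mulN1r. Qed.

Lemma formNr u v : B u (- v) = - B u v.
Proof. by rewrite -scaleN1r formZr mulN1r. Qed.

Definition formE := (formDl, formDr, formNl, formNr, formZl, formZr, form0l, form0r).

Lemma form_eq0 x : B x x = 0 -> x = 0.
Proof. by move=> Bx; apply/eqP/negPn/negP => /HBpos; rewrite Bx ltxx. Qed.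

(* Linear identities in V are reduced to [ring] identities by pairing both sides
   with an arbitrary vector. *)
Lemma form_ext u v : (forall z, B u z = B v z) -> u = v.
Proof.
move=> H; apply/eqP; rewrite -subr_eq0; apply/eqP/form_eq0.
by rewrite formDl formNl H subrr.
Qed.

Lemma homog_neg n v : n < 0 -> homog n v -> v = 0.
Proof. by case: HV => H _ _ n0; rewrite H. Qed.

Lemma homog1_eq0 v : homog 1 v -> v = 0.
Proof. by case: HV => _ _ ->. Qed.

Lemma homog0_vac v : homog 0 v -> v = B v (vac V) *: vac V.
Proof. by case: HV => _ -> _ [k _ <-]; rewrite formZl HB1 mulr1. Qed.

Lemma vprod_gt3 x n y : G x -> G y -> 3 < n -> vprod x n y = 0.
Proof. by move=> Gx Gy n3; apply: homog_neg (homog_vprod n Gx Gy); lia. Qed.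

Lemma vprod2_eq0 x y : G x -> G y -> vprod x 2 y = 0.
Proof. by move=> Gx Gy; apply: homog1_eq0; exact: (homog_vprod 2 Gx Gy). Qed.

Lemma griess_closed x y : G x -> G y -> G (vprod x 1 y).
Proof. by move=> Gx Gy; exact: (homog_vprod 1 Gx Gy). Qed.

(** L(1)x lies in V_1 = 0, so only the term i = 0 of the invariance sum survives, with sign
    (-1)^2. *)
Lemma form_adjoint x n u v : G x -> B (vprod x n u) v = B u (vprod x (2 - n) v).
Proof.
move=> Gx; case: HB => _ _ /(_ 2 n x u v Gx) H.
have /= := @near_sum_trunc R R^o (fun i => if i == 0%N then B (vprod x n u) v else 0)
  (fun i => (i`!%:R)^-1 * B u (vprod (iter i (vprod (vomega V) 2) x) (2 * 2 - n - i%:Z - 2) v)) 1%N.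
rewrite !big_ord1 /= fact0 invr1 mul1r (_ : 2 * 2 - n - 0%Z - 2 = 2 - n); last by lia.
apply => [[]//|[//|i] _|].
  rewrite iterSr (_ : vprod _ 2 x = 0); last first.
    by apply: homog1_eq0; exact: (homog_vprod 2 (@homog_vomega R V) Gx).
  rewrite (_ : iter i _ 0 = 0) ?vprod0l ?form0r ?mulr0//.
  by elim: i => //= i ->; rewrite vprod0r.
case: H => N _ HN; exists N.+1 => // -[//|K] /= NK.
rewrite big_ord_recl /= big1 ?addr0//.
by have /= -> := HN K.+1 (ltnW NK); rewrite -exprnP sqrrN expr1n mul1r.
Qed.

(** In the skew-symmetry formula the corrections come from x_(2)y, which lies in V_1 = 0, from
    x_(3)y, a multiple of the vacuum with only the mode -1, and from products of negative weight. *)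
Lemma vprod_even_sym (l : int) x y : G x -> G y -> l = 1 \/ l = 3 ->
  vprod x l y = vprod y l x.
Proof.
move=> Gx Gy l13; rewrite [RHS](@vskew R V 2 l) => [|i i2]; last first.
  by apply: vprod_gt3 => //; case: l13 => ->; lia.
have z2 : vprod x 2 y = 0 by exact: vprod2_eq0.
have z4 : vprod x 4 y = 0 by exact: vprod_gt3.
have z5 : vprod x 5 y = 0 by exact: vprod_gt3.
have z3 n : vprod (vprod x 3 y) n (vac V) = if n == -1 then vprod x 3 y else 0.
  have {1}-> : vprod x 3 y = B (vprod x 3 y) (vac V) *: vac V.
    by apply: homog0_vac; exact: (homog_vprod 3 Gx Gy).
  rewrite vprodZl vac_id; case: ifP; rewrite ?scaler0// -homog0_vac//.
  exact: (homog_vprod 3 Gx Gy).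
rewrite !big_ord_recr big_ord0 /= binz0.
by case: l13 => ->; rewrite ?(z2, z4, z5, z3, vprod0l, scaler0, addr0, add0r)
  ?subP0 ?vcreation ?scale1r //= ?scaler0 ?addr0 ?vcreation
  -?exprnP (exprS, expr1z) ?sqrrN ?expr1n ?mulr1 ?opprK ?scale1r.
Qed.

Lemma vprod3E x y : G x -> G y -> vprod x 3 y = B x y *: vac V.
Proof.
move=> Gx Gy; rewrite (@vprod_even_sym 3) //; last by right.
rewrite [LHS]homog0_vac; last exact: (homog_vprod 3 Gy Gx).
by rewrite form_adjoint// (_ : 2 - 3 = -1)// vcreation.
Qed.

Lemma form_sym x y : G x -> G y -> B x y = B y x.
Proof.
move=> Gx Gy; have := vprod3E Gx Gy; rewrite (@vprod_even_sym 3)//; last by right.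
rewrite vprod3E// => /(congr1 (B ^~ (vac V))).
by rewrite !formZl HB1 !mulr1 => ->.
Qed.

Lemma griessC x y : G x -> G y -> vprod x 1 y = vprod y 1 x.
Proof. by move=> Gx Gy; apply: vprod_even_sym => //; left. Qed.

Lemma griess_assoc x u v : G x -> B (vprod x 1 u) v = B u (vprod x 1 v).
Proof. by move=> Gx; rewrite form_adjoint. Qed.

(** * Virasoro modes of a conformal vector of central charge 1/2 *)

Section Conformal.
Variable e : V.
Hypothesis He : conformal_vector (1 / 2) e.
Local Notation E := (vprod e).
Local Notation o := (vac V).

Lemma conformal_homog : G e. Proof. by case: He. Qed.

Lemma conformal_form : B e e = 1 / 4.
Proof.
case: He => Ge _ /esym; rewrite vprod3E// => /(congr1 (B ^~ o)).
by rewrite !formZl HB1 => H; lra.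
Qed.

(** Skew-symmetry of e with itself reads e_(0)e = - e_(0)e + 2 e_(-2)1, which determines e_(0)e. *)
Lemma conformal_mode0 : E 0 e = vprod (vomega V) 0 e.
Proof.
have [Ge e1 e3] := He; have e2 : E 2 e = 0 by exact: vprod2_eq0.
have e3' : E 3 e = (1 / 2 / 2) *: o by [].
have de : vprod (vomega V) 0 e = vprod e (- 2) o.
  by rewrite -[LHS]vcreation vderivative rmorphN opprK scale1r.
have := @vskew R V 3 0 e e; rewrite !big_ord_recr big_ord0 /= => H.
apply: form_ext => z; have /(congr1 (B ^~ z)) : E 0 e = - (E 0 e - 2 *: E (- 2) o).
  rewrite {1}H => [|i i3]; last by rewrite add0r; apply: vprod_gt3 => //; lia.
  rewrite !add0r e1 e2 e3' !vprodE vac_id /= !scaler0 !addr0 !binzS binz0.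
  rewrite expr0z scaleN1r scale1r ?subP0 vcreation mul1r subr0 divr1.
  by rewrite rmorphN scaleN1r.
by rewrite de !formE => ?; lra.
Qed.

(** Here e_(m) = L(m-1), so the central term is ((m-1)^3 - (m-1))/12 times 1/2. *)
Lemma virasoro m n v : E m (E n v) - E n (E m v) =
  (m - n)%:~R *: E (m + n - 1) v
  + (if m + n == 2 then (m * (m - 1) * (m - 2))%:~R / 24 else 0) *: v.
Proof.
have [Ge e1 e3] := He; have e2 : E 2 e = 0 by exact: vprod2_eq0.
have e3' : E 3 e = (1 / 2 / 2) *: o by [].
rewrite (@vcommutator R V 3) => [|i i3]; last first.
  by rewrite (vprod_gt3 Ge Ge) ?vprod0l ?scaler0//; lia.
rewrite !big_ord_recr big_ord0 /= add0r conformal_mode0 e1 e2 e3' vderivative !vprodE scaler0 addr0.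
rewrite vac_id subP0 (_ : (m + n - 3 == -1) = (m + n == 2)); last first.
  by apply/eqP/eqP; lia.
rewrite !binzS binz0; apply: form_ext => z.
by case: eqP => _; rewrite !formE !(intrM, intrD, intrN); field.
Qed.

(** A rewriting form without central term: it is absent when m + n differs from 2, and has
    coefficient 0 for m = 2. The variables [l] and [c] let callers give the index and the
    coefficient as numerals. *)
Lemma virasoroE m n (l : int) (c : R) v :
  m + n - 1 = l -> (m - n)%:~R = c -> (m + n != 2) || (m == 2) ->
  E m (E n v) = E n (E m v) + c *: E l v.
Proof.
move=> <- <- mn; apply/eqP; rewrite addrC -subr_eq virasoro.
case: eqP mn => [_ /eqP->|_ _]; last by rewrite scale0r addr0.
by rewrite subrr mulr0 mul0r scale0r addr0.
Qed.

Lemma virasoro31 v : E 3 (E (-1) v) = E (-1) (E 3 v) + 4 *: E 1 v + (1 / 4) *: v.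
Proof.
have /eqP := virasoro 3 (-1) v; rewrite subr_eq => /eqP ->.
apply: form_ext => z; rewrite !formE (_ : 3 + -1 - 1 = 1 :> int)//=.
rewrite (_ : (3 - -1)%:~R = 4 :> R)// (_ : (3 * (3 - 1) * (3 - 2))%:~R = 6 :> R)//.
by field.
Qed.

(* The singular vector of weight 6 in the Verma module of central charge 1/2
   and highest weight 0. *)
Definition singular6 : V :=
  64 *: E (-1) (E (-1) (E (-1) o)) + 93 *: E (-2) (E (-2) o)
  - 264 *: E (-3) (E (-1) o) - 108 *: E (-5) o.

Lemma conformal_vac n : 0 <= n -> E n o = 0.
Proof. exact: vcreation_reg. Qed.

Lemma singular6_mode2 : E 2 singular6 = 0.
Proof.
have c21 v : E 2 (E (-1) v) = E (-1) (E 2 v) + 3 *: E 0 v by exact: virasoroE.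
have c22 v : E 2 (E (-2) v) = E (-2) (E 2 v) + 4 *: E (-1) v by exact: virasoroE.
have c23 v : E 2 (E (-3) v) = E (-3) (E 2 v) + 5 *: E (-2) v by exact: virasoroE.
have c25 v : E 2 (E (-5) v) = E (-5) (E 2 v) + 7 *: E (-4) v by exact: virasoroE.
have c01 v : E 0 (E (-1) v) = E (-1) (E 0 v) + 1 *: E (-2) v by exact: virasoroE.
have c02 v : E 0 (E (-2) v) = E (-2) (E 0 v) + 2 *: E (-3) v by exact: virasoroE.
have c_21 v : E (-2) (E (-1) v) = E (-1) (E (-2) v) + (-1) *: E (-4) v.
  exact: virasoroE.
have z2 : E 2 o = 0 by exact: conformal_vac.
have z0 : E 0 o = 0 by exact: conformal_vac.
rewrite /singular6.
rewrite !(c21, c22, c23, c25, c01, c02, c_21, z2, z0, vprodE, scaler0, addr0, add0r).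
apply: form_ext => z; rewrite !formE; ring.
Qed.

Lemma singular6_mode3 : E 3 singular6 = 0.
Proof.
have c31 := virasoro31.
have c32 v : E 3 (E (-2) v) = E (-2) (E 3 v) + 5 *: E 0 v by exact: virasoroE.
have c33 v : E 3 (E (-3) v) = E (-3) (E 3 v) + 6 *: E (-1) v by exact: virasoroE.
have c35 v : E 3 (E (-5) v) = E (-5) (E 3 v) + 8 *: E (-3) v by exact: virasoroE.
have c11 v : E 1 (E (-1) v) = E (-1) (E 1 v) + 2 *: E (-1) v by exact: virasoroE.
have c02 v : E 0 (E (-2) v) = E (-2) (E 0 v) + 2 *: E (-3) v by exact: virasoroE.
have z3 : E 3 o = 0 by exact: conformal_vac.
have z1 : E 1 o = 0 by exact: conformal_vac.
have z0 : E 0 o = 0 by exact: conformal_vac.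
rewrite /singular6.
rewrite !(c31, c32, c33, c35, c11, c02, z3, z1, z0, vprodE, scaler0, addr0, add0r).
by apply: form_ext => z; rewrite !formE; field.
Qed.

(** The monomials of [singular6] start with the modes -1, -2, -3, -5, whose adjoints are the modes
    3, 4, 5, 7. These kill the vector because the modes 2 and 3 do and generate the others by
    commutators. *)
Lemma singular6_eq0 : singular6 = 0.
Proof.
have z2 := singular6_mode2; have z3 := singular6_mode3.
have z4 : E 4 singular6 = 0.
  have : E 3 (E 2 singular6) = E 2 (E 3 singular6) + 1 *: E 4 singular6 by exact: virasoroE.
  by rewrite z2 z3 !vprodE add0r scale1r.
have z5 : E 5 singular6 = 0.
  have : E 4 (E 2 singular6) = E 2 (E 4 singular6) + 2 *: E 5 singular6 by exact: virasoroE.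
  by rewrite z2 z4 !vprodE add0r => /esym/eqP; rewrite scaler_eq0 pnatr_eq0 => /eqP.
have z7 : E 7 singular6 = 0.
  have : E 5 (E 3 singular6) = E 3 (E 5 singular6) + 2 *: E 7 singular6 by exact: virasoroE.
  by rewrite z3 z5 !vprodE add0r => /esym/eqP; rewrite scaler_eq0 pnatr_eq0 => /eqP.
have Ge := conformal_homog; apply: form_eq0.
suff H t : E 3 t = 0 -> E 4 t = 0 -> E 5 t = 0 -> E 7 t = 0 -> B singular6 t = 0.
  exact: H.
move=> t3 t4 t5 t7; rewrite /singular6 !formE !(form_adjoint _ _ _ Ge) !opprK.
rewrite (_ : 2 + 1 = 3 :> int)// (_ : 2 + 2 = 4 :> int)// (_ : 2 + 3 = 5 :> int)//.
by rewrite (_ : 2 + 5 = 7 :> int)// t3 t4 t5 t7 !vprodE !formE; ring.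
Qed.

Lemma primary x n : G x -> B e x = 0 -> 1 < n -> E n x = 0.
Proof.
move=> Gx ex n1; have Ge := conformal_homog.
have [->|n2] := eqVneq n 2; first exact: vprod2_eq0.
have [->|n3] := eqVneq n 3; first by rewrite vprod3E// ex scale0r.
by apply: vprod_gt3 => //; lia.
Qed.

Lemma conformal_mode1_stable x : G x -> B e x = 0 -> G (E 1 x) /\ B e (E 1 x) = 0.
Proof.
move=> Gx ex; have Ge := conformal_homog; split; first exact: griess_closed.
by case: He => _ e1 _; rewrite -griess_assoc// e1 formZl ex mulr0.
Qed.

(** The zero mode of a vector of weight 6 has index 5; [T1] to [T4] evaluate it on x one monomial at
    a time. The resulting polynomial is 2h(2h - 1)(16h - 1). *)
Lemma conformal_spectrum x : G x -> B e x = 0 ->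
  64 *: E 1 (E 1 (E 1 x)) - 36 *: E 1 (E 1 x) + 2 *: E 1 x = 0.
Proof.
move=> Gx ex; have Ge := conformal_homog.
have P n y : G y -> B e y = 0 -> 1 < n -> E n y = 0 by move=> *; exact: primary.
have [Ghx ehx] := conformal_mode1_stable Gx ex.
have c20 v : E 2 (E 0 v) = E 0 (E 2 v) + 2 *: E 1 v by exact: virasoroE.
have c10 v : E 1 (E 0 v) = E 0 (E 1 v) + 1 *: E 0 v by exact: virasoroE.
have c30 v : E 3 (E 0 v) = E 0 (E 3 v) + 3 *: E 2 v by exact: virasoroE.
have sgnN (n : nat) : (-1) ^ Negz n = (-1) ^+ n.+1 :> R.
  by rewrite -[LHS]/((-1) ^- n.+1) -exprVn invrN1.
have s1 : (-1) ^ (-1) = -1 :> R by rewrite (sgnN 0%N) expr1.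
have s2 : (-1) ^ (-2) = 1 :> R by rewrite (sgnN 1%N); ring.
have s3 : (-1) ^ (-3) = -1 :> R by rewrite (sgnN 2%N); ring.
have s5 : (-1) ^ (-5) = -1 :> R by rewrite (sgnN 4%N); ring.
have P3 y : G y -> B e y = 0 -> forall i : int, 3 <= i -> E i y = 0.
  by move=> Gy ey i i3; apply: P => //; lia.
have P2 y : G y -> B e y = 0 -> forall i : int, 2 < i -> E i y = 0.
  by move=> Gy ey i i3; apply: P => //; lia.
have Q2 (i : int) : 2 < i -> E i (E 0 x) = 0.
  move=> i2; rewrite (@virasoroE i 0 (i - 1) i%:~R); try lia; last by rewrite subr0.
  by rewrite (P i x)// ?(P (i - 1) x)// ?vprod0r ?scaler0 ?addr0//; lia.
set w := E (-1) e.
have w3 y : G y -> B e y = 0 -> vprod w 3 y = 2 *: E 1 y + E 1 (E 1 y).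
  move=> Gy ey; rewrite /w (vassociator3_vanish (P2 y Gy ey) (P3 y Gy ey) s1).
  rewrite (P 2 y)// vprod0r scaler0 subr0 (_ : 3 + -1 - 1 = 1 :> int)//.
  rewrite (_ : 3 + -1 = 2 :> int)// c20 (P 2 y)// vprod0r add0r.
  by apply: form_ext => z; rewrite !formE; ring.
have w4 : vprod w 4 (E 0 x) = 8 *: E 1 x + 4 *: E 1 (E 1 x).
  rewrite /w (vassociator3_vanish Q2 _ s1); last by move=> i i4; apply: Q2; lia.
  rewrite (_ : 4 + -1 - 1 = 2 :> int)// (_ : 4 + -1 - 2 = 1 :> int)//.
  rewrite (_ : 4 + -1 = 3 :> int)// !(c20, c10, c30, vprodDr, vprodZr) !(P 2)// !(P 3)//.
  rewrite !vprodE.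
  by apply: form_ext => z; rewrite !formE; field.
have w5 n : 5 <= n -> vprod w n x = 0.
  move=> n5; rewrite /w (vassociator3_vanish (P2 x Gx ex) _ s1); last first.
    by move=> i i4; apply: P => //; lia.
  rewrite (Q2 (n + -1)); last by lia.
  rewrite (P (n + -1 - 1))//; last by lia.
  by rewrite (P 2 x)// vprod0r !scaler0 subr0 addr0.
have v_mode n y : vprod (E (-2) o) n y = - n%:~R *: E (n - 1) y.
  have -> : E (-2) o = vprod (vomega V) 0 e.
    by rewrite -[RHS]vcreation vderivative rmorphN opprK scale1r.
  exact: vderivative.
have T1 : vprod (E (-1) w) 5 x = 8 *: E 1 x + 6 *: E 1 (E 1 x) + E 1 (E 1 (E 1 x)).
  rewrite (vassociator3_vanish (P2 x Gx ex) w5 s1) (P 2 x)// vprod0r scaler0 subr0.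
  rewrite (_ : 5 + -1 - 1 = 3 :> int)// (_ : 5 + -1 = 4 :> int)// w4 w3//.
  by apply: form_ext => z; rewrite !formE; ring.
have T2 : vprod (E (-2) (E (-2) o)) 5 x = 6 *: E 1 x + 4 *: E 1 (E 1 x).
  rewrite (vassociator3_vanish (P2 x Gx ex) _ s2); last first.
    by move=> i i5; rewrite v_mode P ?scaler0//; lia.
  rewrite (P 2 x)// vprod0r scaler0 subr0 !v_mode.
  rewrite (_ : 5 + -2 - 1 - 1 = 1 :> int)// (_ : 5 + -2 - 1 = 2 :> int)//.
  rewrite (_ : 5 + -2 = 3 :> int)// c20 (P 2 x)// vprod0r add0r.
  by apply: form_ext => z; rewrite !formE; ring.
have T3 : vprod (E (-3) e) 5 x = 2 *: E 1 x + 3 *: E 1 (E 1 x).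
  rewrite (vassociator3_vanish (P2 x Gx ex) _ s3); last first.
    by move=> i i5; apply: P => //; lia.
  rewrite (P 2 x)// vprod0r scaler0 subr0.
  rewrite (_ : 5 + -3 - 1 = 1 :> int)// (_ : 5 + -3 = 2 :> int)//.
  rewrite c20 (P 2 x)// vprod0r add0r.
  by apply: form_ext => z; rewrite !formE; ring.
have T4 : vprod (E (-5) o) 5 x = 5 *: E 1 x.
  rewrite (vassociator3_vanish (P2 x Gx ex) _ s5); last first.
    by move=> i i5; rewrite vac_id; case: eqP => // ?; lia.
  rewrite (P 2 x)// vprod0r scaler0 subr0 !vac_id /=.
  by apply: form_ext => z; rewrite !formE; ring.
have := congr1 (fun s => vprod s 5 x) singular6_eq0.
rewrite /singular6 !vprodE !vcreation T1 T2 T3 T4 => H.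
apply: form_ext => z; have := congr1 (B ^~ z) H; rewrite !formE => {}H.
by rewrite -[RHS]H; ring.
Qed.

Lemma griess_comm1 n u v :
  E 1 (vprod u n v) = vprod u n (E 1 v) + vprod (E 0 u) (n + 1) v
                      + vprod (E 1 u) n v.
Proof.
apply/eqP; rewrite -addrA addrC -subr_eq; apply/eqP.
rewrite (@vcommutator R V 1) => [|i i1]; last by rewrite (binz_nat_small R i1) scale0r.
have b1 : binz R 1 1 = 1 by rewrite binzS binz0 mul1r subr0 divr1.
rewrite !big_ord_recr big_ord0 /= add0r b1 binz0 !scale1r.
by rewrite [1 + n]addrC ?subP0 addrK.
Qed.

Lemma griess_comm0 n u v :
  E 0 (vprod u n v) = vprod u n (E 0 v) + vprod (E 0 u) n v.
Proof.
apply/eqP; rewrite addrC -subr_eq; apply/eqP.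
rewrite (@vcommutator R V 0) => [|i i1]; last by rewrite (binz_nat_small R i1) scale0r.
by rewrite big_ord_recr big_ord0 /= add0r binz0 scale1r add0r ?subP0.
Qed.

Definition weight_space h x := [/\ G x, B e x = 0 & E 1 x = h *: x].

(** The square norm of e_(0)x is (x, e_(2)e_(0)x) = 2 (x, e_(1)x) = 0, so e_(0)x vanishes and e_(1)
    commutes with x_(1). *)
Lemma fusion0 h x y : weight_space 0 x -> weight_space h y ->
  E 1 (vprod x 1 y) = h *: vprod x 1 y.
Proof.
move=> [Gx ex hx] [Gy ey hy]; have Ge := conformal_homog.
have x0 : E 0 x = 0.
  apply: form_eq0; rewrite (form_adjoint _ _ _ Ge) subr0 (@virasoroE 2 0 1 2)//.
  by rewrite hx (primary (n:=2))// scale0r !vprodE scaler0 addr0 form0r.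
by rewrite griess_comm1 x0 hx hy scale0r !vprodE !addr0.
Qed.

(* The singular vector of weight 5/2 in the Verma module of highest weight
   1/2. *)
Lemma half_descendant x : weight_space (1 / 2) x ->
  E 0 (E 0 x) - (4 / 3) *: E (-1) x = 0.
Proof.
move=> [Gx ex hx]; have Ge := conformal_homog.
have x2 : E 2 x = 0 by exact: primary.
have x3 : E 3 x = 0 by exact: primary.
have c20 v : E 2 (E 0 v) = E 0 (E 2 v) + 2 *: E 1 v by exact: virasoroE.
have c10 v : E 1 (E 0 v) = E 0 (E 1 v) + 1 *: E 0 v by exact: virasoroE.
have c30 v : E 3 (E 0 v) = E 0 (E 3 v) + 3 *: E 2 v by exact: virasoroE.
have c21 v : E 2 (E (-1) v) = E (-1) (E 2 v) + 3 *: E 0 v by exact: virasoroE.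
set z := _ - _.
have z2 : E 2 z = 0.
  rewrite /z !(c20, c10, c21, x2, hx, vprodE).
  by apply: form_ext => y; rewrite !formE; field.
have z3 : E 3 z = 0.
  rewrite /z !(c30, virasoro31, c20, c10, c21, x2, x3, hx, vprodE).
  by apply: form_ext => y; rewrite !formE; field.
apply: form_eq0; suff H t : E 2 t = 0 -> E 3 t = 0 -> B z t = 0 by exact: H.
move=> t2 t3; rewrite /z !formE !(form_adjoint _ _ _ Ge) subr0 opprK.
by rewrite (_ : 2 + 1 = 3 :> int)// t2 t3 !vprodE !formE mulr0 subr0.
Qed.

(** Commuting e_(1) through the modes expresses every pairing of z with a descendant of x acting on
    y by the number [M]. The null vector of [half_descendant] then gives (3/4 - 4/3) M = 0. *)
Lemma fusion_half x y z : weight_space (1 / 2) x -> weight_space (1 / 2) y ->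
  weight_space (1 / 2) z -> B z (vprod x 1 y) = 0.
Proof.
move=> hwx [Gy ey hy] [Gz ez hz]; have [Gx ex hx] := hwx; have Ge := conformal_homog.
have adj u : B z (E 1 u) = 1 / 2 * B z u by rewrite -griess_assoc// hz formZl.
set M := B z _.
have M0 : B z (vprod (E 0 x) 2 y) = - (1 / 2) * M.
  have /(congr1 (B z)) := griess_comm1 1 x y.
  rewrite adj hx hy !vprodE !formE (_ : 1 + 1 = 2 :> int)// -/M => H; lra.
have M1 : B z (vprod (E (-1) x) 3 y) = M.
  rewrite (vassociator3 _ _ (signrN1 R)); last 2 first.
  - by move=> i i2; apply: primary => //; lia.
  - by move=> i i3; apply: vprod_gt3.
  rewrite (primary (n:=2))// vprod3E// hy vprod0r scaler0 subr0.
  rewrite (_ : 3 + -1 - 1 = 1 :> int)// (_ : 3 + -1 = 2 :> int)//.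
  have /eqP := griess_comm0 2 x y; rewrite vprod2_eq0// vprod0r.
  rewrite eq_sym addr_eq0 => /eqP ->.
  by rewrite !vprodE vcreation !formE M0 -/M (form_sym Gz Ge) ez; field.
have M2 : B z (vprod (E 0 (E 0 x)) 3 y) = 3 / 4 * M.
  have /(congr1 (B z)) := griess_comm1 2 (E 0 x) y.
  rewrite (@virasoroE 1 0 0 1)// adj hx hy !vprodE !formE (_ : 2 + 1 = 3 :> int)//.
  by rewrite M0 => H; lra.
have /(congr1 (fun u => B z (vprod u 3 y))) := half_descendant hwx.
by rewrite !vprodE !formE M1 M2 => H; lra.
Qed.

(** * Irreducibility of highest weight modules *)

Section HighestWeight.
Variables (h : R) (v : V).
Hypotheses (v_neq0 : v != 0) (hv : E 1 v = h *: v).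
Hypothesis hv_gt : forall n, 0 < n -> E (n + 1) v = 0.

(** Only lowering modes are constructors, so that an induction meets weights increasing from h;
    stability under the other modes follows by commuting them towards [v]. *)
Inductive hw_module : V -> Prop :=
| HwGen : hw_module v
| HwLin k x y : hw_module x -> hw_module y -> hw_module (k *: x + y)
| HwLower n x : n <= 0 -> hw_module x -> hw_module (E n x).

Lemma hw_module0 : hw_module 0.
Proof. by rewrite -(subrr v) addrC -scaleN1r; apply: HwLin; exact: HwGen. Qed.

Lemma hw_moduleD x y : hw_module x -> hw_module y -> hw_module (x + y).
Proof. by move=> hx hy; rewrite -[x]scale1r; exact: HwLin. Qed.

Lemma hw_moduleZ k x : hw_module x -> hw_module (k *: x).
Proof. by move=> hx; rewrite -[_ *: _]addr0; apply: HwLin hw_module0. Qed.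

Lemma hw_module_mode n x : hw_module x -> hw_module (E n x).
Proof.
move=> hx; elim: hx n => {x} [n|k x y _ IHx _ IHy n|k x k0 hx IH n].
- have [n0|n0] := leP n 0; first by apply: HwLower => //; exact: HwGen.
  have [->|n1] := eqVneq n 1; first by rewrite hv; apply: hw_moduleZ HwGen.
  rewrite -(subrK 1 n) hv_gt; first exact: hw_module0.
  by lia.
- by rewrite vprodDr vprodZr; apply: HwLin.
- have /eqP := virasoro n k x; rewrite subr_eq => /eqP ->.
  apply: hw_moduleD; last exact: HwLower.
  by apply: HwLin => //; exact: hw_moduleZ.
Qed.

(** The vectors all of whose modes preserve the module form a subalgebra, by the associator formula,
    and this subalgebra contains e. *)
Lemma hw_module_closed u n x :
  vgenerated [set e] u -> hw_module x -> hw_module (vprod u n x).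
Proof.
move=> Uu; suff : (vgenerated [set e] `<=` [set u | forall n x, hw_module x ->
    hw_module (vprod u n x)]) by move=> /(_ u Uu) H; exact: H.
apply: smallest_sub => [|_ -> k y]; last exact: hw_module_mode.
split.
- split=> [k y _|k y z Hy Hz m t ht]; first by rewrite vprod0l; exact: hw_module0.
  by rewrite vprodDl vprodZl; apply: HwLin; [exact: Hy|exact: Hz].
- move=> k y hy; rewrite vac_id; case: eqP => // _; exact: hw_module0.
- move=> a l b Ha Hb k y hy.
  have [N1 HN1] := vprod_trunc a y; have [N2 HN2] := vprod_trunc b y.
  rewrite (@vassociator R V (`|N1| + `|N2 - k|)) => [|i Ki|i Ki]; last 2 first.
  + by apply: HN1; lia.
  + by apply: HN2; lia.
  elim/big_ind: _ => [||i _]; [exact: hw_module0|exact: hw_moduleD|].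
  apply: hw_moduleZ; apply: hw_moduleD; first exact/Ha/Hb.
  by rewrite -scaleN1r scalerA; apply: hw_moduleZ; exact/Hb/Ha.
Qed.

(** A product of commuting self-adjoint operators, the factor of index j killing the weight h + j +
    1. It isolates the top weight without constructing the weight decomposition of the module. *)
Let shift (s : seq nat) x := foldr (fun j y => E 1 y - (h + j.+1%:R) *: y) x s.

Let shift_lin s k x y : shift s (k *: x + y) = k *: shift s x + shift s y.
Proof.
elim: s => //= j s ->; apply: form_ext => z.
by rewrite !vprodE !formE; ring.
Qed.

Let shift0 s : shift s 0 = 0.
Proof. by have := shift_lin s (-1) 0 0; rewrite scaler0 addr0 scaleN1r addNr. Qed.

Let shiftZ s k x : shift s (k *: x) = k *: shift s x.
Proof. by have := shift_lin s k x 0; rewrite shift0 !addr0. Qed.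

Let shift_gen s : exists2 a, shift s v = a *: v & a != 0.
Proof.
elim: s => [|j s [a /= -> a0]]; first by exists 1; rewrite ?scale1r ?oner_eq0.
exists (- j.+1%:R * a); last by rewrite mulf_neq0// oppr_eq0 pnatr_eq0.
by apply: form_ext => z; rewrite vprodZr hv !formE; ring.
Qed.

Let shift_lower s n x : n <= 0 ->
  shift [seq (j + `|(1 - n : int)|)%N | j <- s] (E n x) = E n (shift s x).
Proof.
move=> n0; elim: s => //= j s ->; rewrite (@virasoroE 1 n n (1 - n)%:~R); last 3 first.
- by lia.
- by [].
- by lia.
have -> : (j + `|(1 - n : int)|).+1%:R = j.+1%:R + (1 - n)%:~R :> R.
  by rewrite -addSn natrD -[in RHS](gez0_abs (_ : 0 <= 1 - n))//; lia.
by apply: form_ext => z; rewrite !vprodE !formE; ring.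
Qed.

Let shift_comm s t x : shift s (shift t x) = shift t (shift s x).
Proof.
have step j (y : V) : shift t (E 1 y - (h + j.+1%:R) *: y) =
    E 1 (shift t y) - (h + j.+1%:R) *: shift t y.
  elim: t => //= i t ->; apply: form_ext => z.
  by rewrite !vprodE !formE; ring.
by elim: s => //= j s ->; rewrite step.
Qed.

(* A shift projects onto the top weight space, which is the line of [v]. *)
Let shift_top x : hw_module x -> exists s c, shift s x = c *: v.
Proof.
elim=> {x} [|k x y _ [s [c hs]] _ [t [d ht]]|n x n0 _ [s [c hs]]].
- by exists [::], 1; rewrite scale1r.
- have [a ha _] := shift_gen s; have [b hb _] := shift_gen t.
  exists (s ++ t), (k * (c * b) + d * a).
  rewrite /shift foldr_cat -/(shift t _) -/(shift s _) !shift_lin shift_comm hs ht.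
  by rewrite !shiftZ ha hb !scalerA -scalerDl !mulrA.
(* The tail of the list sends the vector to c e_(n)v, of weight h + (1 - n); the head kills it. The
   predecessor compensates for the factor j standing for h + j + 1. *)
- exists (`|(1 - n : int)|.-1 :: [seq (j + `|(1 - n : int)|)%N | j <- s]), 0.
  rewrite /= shift_lower// hs !vprodZr (@virasoroE 1 n n (1 - n)%:~R); last 3 first.
  + by lia.
  + by [].
  + by lia.
  rewrite prednK; last by lia.
  have -> : `|(1 - n : int)|%:R = (1 - n)%:~R :> R.
    by rewrite -[in RHS](gez0_abs (_ : 0 <= 1 - n))//; lia.
  by apply: form_ext => z; rewrite hv !vprodE !formE; ring.
Qed.

(** A submodule orthogonal to [v] is orthogonal to the whole module, since adjoints of modes of e
    are modes of e; lying inside the module, it is zero. Otherwise some w in it pairs nontrivially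
    with [v]; as the shifts are self-adjoint, the projection of w is a nonzero multiple of [v]. *)
Lemma hw_module_iso_L : iso_L e h hw_module.
Proof.
have Ge := conformal_homog; have Ue : vgenerated [set e] e by exact: sub_gen_smallest.
have subm : vsubmodule (vgenerated [set e]) hw_module.
  split; first by split=> [|k x y]; [exact: hw_module0|exact: HwLin].
  by move=> u n w; exact: hw_module_closed.
split; last by exists v; split=> //; exact: HwGen.
split=> // [hw0|W [[W0 Wlin] Wmode] sW].
  have : [set 0] v by rewrite -hw0; exact: HwGen.
  by move=> /= v0; move: v_neq0; rewrite v0 eqxx.
have [Wv|/existsNP[w /not_implyP[Ww wv]]] := pselect (forall w, W w -> B w v = 0).
  left; apply/seteqP; split=> [w Ww|_ ->//].
  apply: form_eq0; suff : forall y, hw_module y -> forall w, W w -> B w y = 0.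
    by apply=> //; exact: sW.
  move=> y; elim=> {y} [//|k x y _ IHx _ IHy u Wu|n y n0 _ IH u Wu].
    by rewrite formDr formZr IHx// IHy// mulr0 addr0.
  rewrite -(subKr 2 n) -form_adjoint//; apply: IH; exact: Wmode.
right; apply/seteqP; split=> // y hy.
have Wshift s x : W x -> W (shift s x).
  move=> Wx; elim: s => //= j s Ws; rewrite -scaleNr addrC.
  by apply: Wlin => //; exact: Wmode.
have WZ k x : W x -> W (k *: x) by move=> Wx; rewrite -[_ *: _]addr0; exact: Wlin.
have [s [c hs]] := shift_top (sW _ Ww).
have Bshift t : exists2 a, B (shift t w) v = a * B w v & a != 0.
  elim: t => [|j t [a /= IH a0]]; first by exists 1; rewrite ?mul1r ?oner_eq0.
  exists (- j.+1%:R * a); last by rewrite mulf_neq0// oppr_eq0 pnatr_eq0.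
  by rewrite !formE griess_assoc// hv formZr IH; ring.
have c0 : c != 0.
  have [a + a0] := Bshift s; rewrite hs formZl => H.
  by apply: contra_notN wv => /eqP c0; move: H; rewrite c0 mul0r => /esym/eqP;
    rewrite mulf_eq0 (negbTE a0) => /eqP.
have Wv : W v.
  rewrite -[v]scale1r -(mulVf c0) -scalerA -hs; exact/WZ/Wshift.
elim: hy => // [k x z _ Wx _ Wz|n x _ _ Wx]; [exact: Wlin|exact: Wmode].
Qed.

End HighestWeight.

Lemma weight_space_isotypic h x : weight_space h x -> isotypic e h x.
Proof.
move=> [Gx ex hx]; have [->|x0] := eqVneq x 0.
  by exists [::]; split=> //; rewrite big_nil.
exists [:: x]; split; last by rewrite big_seq1.
move=> _ /[1!inE] /eqP ->; exists (hw_module x); last exact: HwGen.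
by apply: hw_module_iso_L => // n n0; apply: primary => //; lia.
Qed.

Lemma conformal_isotypic : isotypic e 0 e.
Proof.
exists [:: e]; split; last by rewrite big_seq1.
move=> _ /[1!inE] /eqP ->; exists (hw_module o).
  apply: hw_module_iso_L => [||n n0].
  - by apply/eqP => o0; move: HB1; rewrite o0 form0l => /eqP; rewrite eq_sym oner_eq0.
  - by rewrite conformal_vac// scale0r.
  - by rewrite conformal_vac//; lia.
by rewrite -[e]vcreation; apply: HwLower => //; exact: HwGen.
Qed.

Lemma weight_space_decomp x : G x -> B e x = 0 -> exists x0 x1 x2,
  [/\ weight_space 0 x0, weight_space (1 / 2) x1, weight_space (1 / 16) x2 &
      x = x0 + x1 + x2].
Proof.
move=> Gx ex; have H := conformal_spectrum Gx ex.
have [Gx1 ex1] := conformal_mode1_stable Gx ex.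
have [Gx2 ex2] := conformal_mode1_stable Gx1 ex1.
have HB3 z : 64 * B (E 1 (E 1 (E 1 x))) z = 36 * B (E 1 (E 1 x)) z - 2 * B (E 1 x) z.
  by have := congr1 (B ^~ z) H; rewrite !formE => ?; lra.
have wsp h (c0 c1 c2 : R) : let y := c0 *: x + c1 *: E 1 x + c2 *: E 1 (E 1 x) in
    (forall z, B (E 1 y) z = h * B y z) -> weight_space h y.
  move=> y hy; split.
  - by do 2?[apply: homogD]; apply: homogZ.
  - by rewrite !formE ex ex1 ex2; ring.
  - by apply: form_ext => z; rewrite hy formZl.
(* The Lagrange interpolation polynomials in e_(1) at the nodes 0, 1/2 and 1/16. *)
exists (1 *: x + (-18) *: E 1 x + 32 *: E 1 (E 1 x)),
  (0 *: x + (- (2 / 7)) *: E 1 x + (32 / 7) *: E 1 (E 1 x)),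
  (0 *: x + (128 / 7) *: E 1 x + (- (256 / 7)) *: E 1 (E 1 x)); split.
- by apply: wsp => z; rewrite !vprodE !formE; have := HB3 z; lra.
- by apply: wsp => z; rewrite !vprodE !formE; have := HB3 z; lra.
- by apply: wsp => z; rewrite !vprodE !formE; have := HB3 z; lra.
- by apply: form_ext => z; rewrite !formE; field.
Qed.

Lemma weight_space_orth h h' x y : h != h' -> weight_space h x ->
  weight_space h' y -> B x y = 0.
Proof.
move=> hh [Gx _ hx] [_ _ hy]; have := griess_assoc x y conformal_homog.
rewrite hx hy formZl formZr => /eqP; rewrite -subr_eq0 -mulrBl mulf_eq0 subr_eq0.
by rewrite (negbTE hh) => /eqP.
Qed.

End Conformal.

(* The coefficients make [griess_reflect a] the identity on the eigenspaces of
   [a_(1)] for 2, 0 and 1/2, and minus the identity on that for 1/16.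
   The definition is locked, as are those of [sigma_vec] and [pair_part0/1], to
   keep the linearity rules from unfolding it. *)
Definition griess_reflect a x := locked (x - (8192 / 217) *:
  (vprod a 1 (vprod a 1 (vprod a 1 x)) - (5 / 2) *: vprod a 1 (vprod a 1 x)
   + vprod a 1 x)).

Lemma griess_reflectD a x y :
  griess_reflect a (x + y) = griess_reflect a x + griess_reflect a y.
Proof. by apply: form_ext => z; rewrite /griess_reflect -!lock !vprodE !formE; ring. Qed.

Lemma griess_reflectZ a k x : griess_reflect a (k *: x) = k *: griess_reflect a x.
Proof. by apply: form_ext => z; rewrite /griess_reflect -!lock !vprodE !formE; ring. Qed.

Lemma griess_reflect_eigen a h x : vprod a 1 x = h *: x ->
  griess_reflect a x = (1 - 8192 / 217 * (h ^+ 3 - 5 / 2 * h ^+ 2 + h)) *: x.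
Proof.
by move=> hx; apply: form_ext => z; rewrite /griess_reflect -!lock !(hx, vprodE) !formE; ring.
Qed.

Lemma griess_decomp a x : conformal_vector (1 / 2) a -> G x -> exists x0 x1 x2,
  [/\ weight_space a 0 x0, weight_space a (1 / 2) x1, weight_space a (1 / 16) x2,
      x = (4 * B a x) *: a + x0 + x1 + x2 &
      griess_reflect a x = (4 * B a x) *: a + x0 + x1 - x2].
Proof.
move=> Ha Gx; have Ga := conformal_homog Ha; have [_ aa _] := Ha.
have [||x0 [x1 [x2 [w0 w1 w2 Hx]]]] := @weight_space_decomp a Ha (x - (4 * B a x) *: a).
- by apply: homogB => //; apply: homogZ.
- by rewrite !formE conformal_form//; field.
have {}Hx : x = (4 * B a x) *: a + x0 + x1 + x2.
  by rewrite -!addrA [x0 + _]addrA -Hx addrC subrK.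
exists x0, x1, x2; split=> //.
rewrite {1}Hx !griess_reflectD griess_reflectZ (griess_reflect_eigen aa).
case: w0 w1 w2 => _ _ /griess_reflect_eigen -> [_ _ /griess_reflect_eigen ->].
case=> _ _ /griess_reflect_eigen ->.
by apply: form_ext => z; rewrite !formE; field.
Qed.

(** The two sides agree on a and on each of the three eigenspaces, because these lie in the isotypic
    parts where [is_tau] prescribes the sign. *)
Lemma tau_reflect a t : conformal_vector (1 / 2) a -> is_tau a t ->
  forall x, G x -> t x = griess_reflect a x.
Proof.
move=> Ha [[tlin _ _ _ _] t0 t1 t2] x Gx.
have [x0 [x1 [x2 [w0 w1 w2 Hx ->]]]] := griess_decomp Ha Gx.
rewrite {1}Hx !(linear_funD tlin) (linear_funZ tlin) (t0 _ (conformal_isotypic Ha)).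
rewrite (t0 _ (weight_space_isotypic Ha w0)).
by rewrite (t1 _ (weight_space_isotypic Ha w1)) (t2 _ (weight_space_isotypic Ha w2)).
Qed.

Lemma automorphism_homog g x : automorphism g -> G x -> G (g x).
Proof.
move=> [glin _ _ gomega gprod]; rewrite /G /homog /= => Gx; rewrite -gomega -gprod Gx.
exact: linear_funZ.
Qed.

Lemma automorphism_form g x y : automorphism g -> G x -> G y -> B (g x) (g y) = B x y.
Proof.
move=> Hg Gx Gy; have [glin _ gvac _ gprod] := Hg.
have := vprod3E (automorphism_homog Hg Gx) (automorphism_homog Hg Gy).
rewrite -gprod vprod3E// (linear_funZ glin) gvac.
by move=> /(congr1 (B ^~ (vac V))); rewrite !formZl HB1 !mulr1 => ->.
Qed.

Lemma automorphism_reflect g a x : automorphism g ->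
  g (griess_reflect a x) = griess_reflect (g a) (g x).
Proof.
move=> [glin _ _ _ gprod]; rewrite /griess_reflect -!lock.
by rewrite !(linear_funD glin, linear_funN glin, linear_funZ glin, gprod).
Qed.

(** What remains of an Ising vector with its involution for computations in V_2. Unlike isotypic
    parts, these data are transported by an automorphism through a direct conjugation. *)
Definition axis a := conformal_vector (1 / 2) a /\
  exists2 t, automorphism t & forall x, G x -> t x = griess_reflect a x.

Lemma automorphism_axis g a : automorphism g -> axis a -> axis (g a).
Proof.
move=> Hg [Ha [t Ht ta]]; have [glin [g' gK g'K] gvac gomega gprod] := Hg.
have Hg' : automorphism g'.
  split=> [k x y|||| u n v].
  - by apply: (can_inj gK); rewrite g'K glin !g'K.
  - by exists g.
  - by rewrite -gvac gK.
  - by rewrite -gomega gK.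
  - by apply: (can_inj gK); rewrite gprod !g'K.
split.
  case: Ha => Ga aa a3; split; first exact: automorphism_homog.
    by rewrite -gprod aa (linear_funZ glin).
  by rewrite -gprod a3 (linear_funZ glin) gvac.
exists (g \o t \o g').
  case: Hg' => glin' _ gvac' gomega' gprod'.
  case: Ht => tlin tbij tvac tomega tprod; split=> [k x y|||| u n v] /=.
  - by rewrite glin' tlin glin.
  - apply: bij_comp; first by apply: bij_comp => //; exists g'.
    by exists g.
  - by rewrite gvac' tvac gvac.
  - by rewrite gomega' tomega gomega.
  - by rewrite gprod' tprod gprod.
move=> x Gx /=; rewrite ta; last exact: automorphism_homog.
by rewrite automorphism_reflect// g'K.
Qed.

Local Notation "x ** y" := (vprod x 1 y) (at level 40).
Local Notation refl := griess_reflect.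

Lemma axis_homog a : axis a -> G a. Proof. by case=> /conformal_homog. Qed.

Lemma axis_idem a : axis a -> a ** a = 2 *: a. Proof. by case=> -[]. Qed.

Lemma axis_form a : axis a -> B a a = 1 / 4.
Proof. by case=> /conformal_form. Qed.

Lemma reflect_homog a x : axis a -> G x -> G (refl a x).
Proof. by move=> [_ [t Ht ta]] Gx; rewrite -ta//; exact: automorphism_homog. Qed.

Lemma reflect_form a x y : axis a -> G x -> G y -> B (refl a x) (refl a y) = B x y.
Proof. by move=> [_ [t Ht ta]] Gx Gy; rewrite -!ta//; exact: automorphism_form. Qed.

Lemma reflect_prod a x y : axis a -> G x -> G y ->
  refl a (x ** y) = refl a x ** refl a y.
Proof.
move=> [_ [t Ht ta]] Gx Gy; rewrite -!ta//; last exact: griess_closed.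
by case: Ht.
Qed.

Lemma reflect_axis a b : axis a -> axis b -> axis (refl a b).
Proof.
move=> [_ [t Ht ta]] Hb; rewrite -ta; last exact: axis_homog.
exact: automorphism_axis.
Qed.

Lemma reflect_self a : axis a -> refl a a = a.
Proof.
move=> /axis_idem/griess_reflect_eigen ->.
by apply: form_ext => z; rewrite !formE; field.
Qed.

Lemma reflectK a x : axis a -> G x -> refl a (refl a x) = x.
Proof.
move=> Ha Gx; have [x0 [x1 [x2 [w0 w1 w2 Hx Hr]]]] := griess_decomp Ha.1 Gx.
have [_ _ w2'] := w2; rewrite Hr [RHS]Hx -[_ - x2](addrK (2 *: x2)).
have -> : (4 * B a x) *: a + x0 + x1 - x2 + 2 *: x2 - 2 *: x2 = x - 2 *: x2.
  by rewrite [in RHS]Hx; apply: form_ext => z; rewrite !formE; ring.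
rewrite griess_reflectD -scaleNr griess_reflectZ (griess_reflect_eigen w2') Hr.
by apply: form_ext => z; rewrite !formE; field.
Qed.

(** * Fusion rules of an axis on V_2 *)

Section FusionRules.
Variable a : V.
Hypothesis Ha : axis a.
Let Ga : G a := axis_homog Ha.

Lemma fusion_00 x : weight_space a 0 x -> a ** (x ** x) = 0.
Proof. by move=> wx; rewrite (fusion0 Ha.1 wx wx) scale0r. Qed.

Lemma fusion_0half x y : weight_space a 0 x -> weight_space a (1 / 2) y ->
  a ** (x ** y) = (1 / 2) *: (x ** y).
Proof. by move=> wx wy; rewrite (fusion0 Ha.1 wx wy). Qed.

(** The reflection fixes x, hence x.x, which has no 1/16-part; the 1/2-part is orthogonal to itself
    by [fusion_half]. The component along a comes from (a, x.x) = (x, x)/2. *)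
Lemma fusion_half_half x : weight_space a (1 / 2) x ->
  a ** (x ** x) = (4 * B x x) *: a.
Proof.
move=> wx; have [Gx ax hx] := wx; set w := x ** x.
have Gw : G w by exact: griess_closed.
have aw : 4 * B a w = 2 * B x x.
  by rewrite (form_sym Ga Gw) griess_assoc// (griessC Gx Ga) hx formZr; field.
have [x0 [x1 [x2 [w0 w1 w2 Hw Hr]]]] := griess_decomp Ha.1 Gw.
have rx : refl a x = x.
  by rewrite (griess_reflect_eigen hx); apply: form_ext => z; rewrite !formE; field.
have x20 : x2 = 0.
  apply: form_ext => z; have := congr1 (B ^~ z) Hw.
  have := congr1 (B ^~ z) Hr; rewrite {1}/w reflect_prod// rx -/w !formE; lra.
have [G1 a1 _] := w1.
have x10 : x1 = 0.
  apply: form_eq0; have := fusion_half Ha.1 wx wx w1; rewrite -/w Hw x20 !formE.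
  by rewrite (form_sym G1 Ga) a1 (weight_space_orth Ha.1 _ w1 w0)//; lra.
have [_ _ h0] := w0.
rewrite Hw x10 x20 aw !addr0 !vprodE h0 scale0r addr0 axis_idem// scalerA.
by congr (_ *: _); ring.
Qed.

End FusionRules.

(** The multiple 1/16 of x cancels the 1/16-component of a.x, so the vector is fixed by the
    reflection at a; adding a makes the expression symmetric. *)
Definition sigma_vec a x := locked (a ** x - (1 / 16) *: (a + x)).

Section Pair.
Variables (a x : V).
Hypotheses (Ha : axis a) (Hx : axis x).
Let Ga : G a := axis_homog Ha.
Let Gx : G x := axis_homog Hx.
Let y := refl a x.
Let Gy : G y := reflect_homog Ha Gx.
Let s := sigma_vec a x.
Let k := B a x.

(** The parts of x of eigenvalue 0 and 1/2 at a. Both x + y and s have no 1/16-component, so these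
    two vectors and a can be solved for the two parts. *)
Definition pair_part0 :=
  locked ((-2) *: s + (12 * k - 1 / 8) *: a + (7 / 16) *: (x + y)).
Definition pair_part1 :=
  locked (2 *: s + (1 / 8 - 16 * k) *: a + (1 / 16) *: (x + y)).

Lemma sigma_homog : G s.
Proof.
rewrite /s /sigma_vec -lock.
by apply: homogB; [exact: griess_closed|apply: homogZ; exact: homogD].
Qed.

Lemma pair_parts : weight_space a 0 pair_part0 /\ weight_space a (1 / 2) pair_part1.
Proof.
have [x0 [x1 [x2 [w0 w1 w2 Hx' Hr]]]] := griess_decomp Ha.1 Gx.
have [_ _ h0] := w0; have [_ _ h1] := w1; have [_ _ h2] := w2.
have sE : s = (8 * k - 1 / 16) *: a + (1 / 2) *: x1 + (1 / 16) *: x2 - (1 / 16) *: x.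
  rewrite /s /sigma_vec -!lock {1}Hx' !vprodE h0 h1 h2 axis_idem//.
  by apply: form_ext => z; rewrite -/k !formE; field.
have -> : pair_part0 = x0.
  by apply: form_ext => z; rewrite /pair_part0 -lock sE /y Hr !formE {1 2}Hx' -/k !formE; field.
have -> : pair_part1 = x1; last by [].
by apply: form_ext => z; rewrite /pair_part1 -lock sE /y Hr !formE {1 2}Hx' -/k !formE; field.
Qed.

End Pair.

Lemma sigmaC a x : G a -> G x -> sigma_vec a x = sigma_vec x a.
Proof. by move=> Ga Gx; rewrite /sigma_vec -!lock griessC// [a + x]addrC. Qed.

Lemma sigmaE a x : a ** x = sigma_vec a x + (1 / 16) *: (a + x).
Proof. by rewrite /sigma_vec -lock subrK. Qed.

Lemma sigma_reflect a x : axis a -> axis x -> refl a (sigma_vec a x) = sigma_vec a x.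
Proof.
move=> Ha Hx; have [_ [_ _ /griess_reflect_eigen H]] := pair_parts Ha Hx.
have -> : sigma_vec a x = (1 / 2) *: (pair_part1 a x + (16 * B a x - 1 / 8) *: a
    + (- (1 / 16)) *: (x + refl a x)).
  by apply: form_ext => z; rewrite /pair_part1 -!lock !formE; field.
move: (pair_part1 a x) H => p H.
rewrite griess_reflectZ !griess_reflectD !griess_reflectZ griess_reflectD H.
rewrite reflect_self// reflectK//; last exact: axis_homog.
by apply: form_ext => z; rewrite !formE; field.
Qed.

Lemma sigmaE_reflect a x : axis a -> axis x ->
  a ** refl a x = sigma_vec a x + (1 / 16) *: (a + refl a x).
Proof.
move=> Ha Hx; have Ga := axis_homog Ha; have Gx := axis_homog Hx.
rewrite -{1}(reflect_self Ha) -reflect_prod// sigmaE griess_reflectD sigma_reflect//.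
by rewrite griess_reflectZ griess_reflectD reflect_self.
Qed.

(** The eigenvalue equation of [pair_part1], solved for the product of a and s. *)
Lemma sigma_mul a x : axis a -> axis x -> a ** sigma_vec a x =
  (7 / 16) *: sigma_vec a x + (12 * B a x - 25 / 256) *: a
  + (7 / 512) *: (x + refl a x).
Proof.
move=> Ha Hx; have [_ [_ _ H]] := pair_parts Ha Hx.
apply: form_ext => z; have := congr1 (B ^~ z) H; rewrite /pair_part1 -lock.
rewrite !vprodE (axis_idem Ha) (sigmaE a x) (sigmaE_reflect Ha Hx) !formE => {}H.
lra.
Qed.

Lemma sigma_mulr a x : axis a -> axis x -> x ** sigma_vec a x =
  (7 / 16) *: sigma_vec a x + (12 * B a x - 25 / 256) *: x
  + (7 / 512) *: (a + refl x a).
Proof.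
move=> Ha Hx; have Ga := axis_homog Ha; have Gx := axis_homog Hx.
by rewrite sigmaC// sigma_mul// (form_sym Ga Gx).
Qed.

Lemma sigma_mul_reflect a x : axis a -> axis x -> refl a x ** sigma_vec a x =
  (7 / 16) *: sigma_vec a x + (12 * B a x - 25 / 256) *: refl a x
  + (7 / 512) *: (a + refl a (refl x a)).
Proof.
move=> Ha Hx; have Ga := axis_homog Ha; have Gx := axis_homog Hx.
rewrite -{1}(sigma_reflect Ha Hx) -reflect_prod//; last exact: sigma_homog.
rewrite sigma_mulr// !griess_reflectD !griess_reflectZ griess_reflectD.
by rewrite sigma_reflect// reflect_self.
Qed.

(** * The products a.t and s.s, obtained from the fusion rules at a *)

Section Resurrection.
Variables (a x : V).
Hypotheses (Ha : axis a) (Hx : axis x).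
Let y := refl a x.
Let x' := refl x a.
Let y' := refl a x'.
Let s := sigma_vec a x.
Let t := sigma_vec x y.
Let s2 := sigma_vec a x'.
Let k := B a x.
Let m := B x y.
Let Ga : G a := axis_homog Ha.
Let Gx : G x := axis_homog Hx.
Let Hy : axis y := reflect_axis Ha Hx.
Let Gy : G y := axis_homog Hy.
Let Hx' : axis x' := reflect_axis Hx Ha.
Let Gs : G s := sigma_homog Ha Hx.

Lemma form_sigmal : B a s = 31 / 16 * k - 1 / 64.
Proof.
rewrite /s /sigma_vec -!lock !formE -griess_assoc// axis_idem// formZl axis_form//.
by rewrite -/k; field.
Qed.

Lemma form_sigmar : B x s = 31 / 16 * k - 1 / 64.
Proof.
rewrite /s /sigma_vec -!lock griessC// !formE -griess_assoc// axis_idem// formZl axis_form//.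
by rewrite (form_sym Gx Ga) -/k; field.
Qed.

Lemma form_reflect : B a y = k.
Proof. by rewrite -{1}(reflect_self Ha); exact: reflect_form. Qed.

Lemma form_sigma_reflect : B s y = B s x.
Proof. by rewrite -[s in LHS](sigma_reflect Ha Hx); exact: reflect_form. Qed.

(** The 1/2-part is orthogonal to a and to the 0-part, so its square norm is its pairing with (x +
    y)/2; this avoids the still unknown (s, s). *)
Lemma pair_part1_form : B (pair_part1 a x) (pair_part1 a x) =
  - 1 / 64 + 4 * k + 1 / 16 * m - 16 * k ^+ 2.
Proof.
have [w0 w1] := pair_parts Ha Hx; have [G1 a1 _] := w1.
have -> : B (pair_part1 a x) (pair_part1 a x) =
    B (pair_part1 a x) ((1 / 2) *: (x + y)).
  have w10 : B (pair_part1 a x) (pair_part0 a x) = 0.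
    by rewrite (weight_space_orth Ha.1 _ w1 w0).
  have -> : (1 / 2) *: (x + y) = pair_part0 a x + pair_part1 a x + (4 * k) *: a.
    by apply: form_ext => z; rewrite /pair_part0 -!lock /pair_part1 -!lock !formE -/k; field.
  by rewrite [RHS]formDr [in RHS]formDr w10 formZr (form_sym G1 Ga) a1 mulr0 add0r addr0.
have yx : B y x = m by exact: form_sym.
rewrite /pair_part1 -!lock -/s -/y -/k !formE form_sigma_reflect (form_sym Gs Gx) form_sigmar.
by rewrite form_reflect yx -/m -/k !axis_form//; field.
Qed.

Let aa : a ** a = 2 *: a := axis_idem Ha.
Let xx : x ** x = 2 *: x := axis_idem Hx.
Let yy : y ** y = 2 *: y := axis_idem Hy.
Let ax : a ** x = s + (1 / 16) *: (a + x) := sigmaE a x.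
Let ay : a ** y = s + (1 / 16) *: (a + y) := sigmaE_reflect Ha Hx.
Let xy : x ** y = t + (1 / 16) *: (x + y) := sigmaE x y.
Let as' : a ** s = _ := sigma_mul Ha Hx.
Let xs : x ** s = (7 / 16) *: s + (12 * k - 25 / 256) *: x + (7 / 512) *: (a + x') :=
  sigma_mulr Ha Hx.
Let ys : y ** s = (7 / 16) *: s + (12 * k - 25 / 256) *: y + (7 / 512) *: (a + y') :=
  sigma_mul_reflect Ha Hx.
Let ax' : a ** x' = s2 + (1 / 16) *: (a + x') := sigmaE a x'.
Let ay' : a ** y' = s2 + (1 / 16) *: (a + y') := sigmaE_reflect Ha Hx'.
Let xa : x ** a = s + (1 / 16) *: (a + x). Proof. by rewrite griessC. Qed.
Let ya : y ** a = s + (1 / 16) *: (a + y). Proof. by rewrite griessC. Qed.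
Let yx : y ** x = t + (1 / 16) *: (x + y). Proof. by rewrite griessC. Qed.
Let sa : s ** a = a ** s. Proof. by rewrite griessC. Qed.
Let sx : s ** x = x ** s. Proof. by rewrite griessC. Qed.
Let sy : s ** y = y ** s. Proof. by rewrite griessC. Qed.
Let mulT := (aa, xx, yy, ax, ay, xy, xa, ya, yx, ax', ay', sa, sx, sy, as', xs, ys).

Let p0 : pair_part0 a x =
  (-2) *: s + (12 * k - 1 / 8) *: a + (7 / 16) *: (x + y).
Proof. by rewrite /pair_part0 -lock. Qed.

Let p1 : pair_part1 a x =
  2 *: s + (1 / 8 - 16 * k) *: a + (1 / 16) *: (x + y).
Proof. by rewrite /pair_part1 -lock. Qed.

(** The left side is symmetric in a and x, while on the right only m = (x, y) is not: exchanging a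
    and x will give (a_1, a_-1) = (a_0, a_2). *)
Lemma sigma_form : B s s = 12 * k ^+ 2 + 65 / 128 * k - 3 / 2048 + 7 / 512 * m.
Proof.
have sE : s = a ** x - (1 / 16) *: (a + x) by rewrite /s /sigma_vec -lock.
rewrite {1}sE !formE griess_assoc// as' -/k -/y !formE.
rewrite form_sigmal form_sigmar (form_sym Gx Ga) -/k axis_form// -/m.
by field.
Qed.

(* Apply a_(1) to the difference of the squares of the two parts: the first
   square is killed and the second one lands on a line. *)
Lemma sigma_reflect_mul : a ** t = (7 / 48) *: s2
  + (256 / 3 * k - 19 / 24) *: s + (8 / 3 * k - 19 / 768) *: (x + y)
  + (7 / 1536) *: (x' + y')
  - (127 / 768 - 80 / 3 * k + 2 / 3 * m + 2048 / 3 * k ^+ 2) *: a.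
Proof.
have [w0 w1] := pair_parts Ha Hx.
(* The two parts contain s with coefficients -2 and 2, so the unknown s.s cancels in the difference
   of squares and t appears with coefficient 3/8. *)
have H : pair_part0 a x ** pair_part0 a x - pair_part1 a x ** pair_part1 a x =
    (32 * k - 2) *: s + (3 / 8) *: t + (75 / 128 - 23 * k) *: (x + y)
    - (7 / 256) *: (x' + y') + (2 * k - 9 / 128 - 32 * k ^+ 2) *: a.
  rewrite p0 p1 !vprodE !mulT; apply: form_ext => z.
  by rewrite -/k -/y !formE; field.
have := congr1 (vprod a 1) H; rewrite vprodDr vprodNr.
rewrite (fusion_00 Ha w0) (fusion_half_half Ha w1) pair_part1_form.
rewrite !vprodE !mulT => {}H; apply: form_ext => z.
have := congr1 (B ^~ z) H; rewrite -/k -/y !formE => {}H.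
lra.
Qed.

(* The product a s^2 occurs both in [fusion_00] and in [fusion_0half];
   eliminating it determines s^2. *)
Lemma sigma_square : 4 *: (s ** s) =
  (- 13 / 96 - 80 / 3 * k) *: s - (7 / 96) *: s2 + (7 / 128) *: t
  + (49 / 6 * k - 245 / 6144) *: (x + y) + (49 / 6144) *: (x' + y')
  + (1792 / 3 * k ^+ 2 - 7 / 3 * k - 7 / 3072 + 7 / 12 * m) *: a.
Proof.
have [w0 w1] := pair_parts Ha Hx.
have H00 : pair_part0 a x ** pair_part0 a x = 4 *: (s ** s) - (49 / 32) *: s
    + (49 / 128) *: t + (1183 / 2048 - 21 * k) *: (x + y)
    - (49 / 2048) *: (x' + y') + (6 * k - 81 / 1024 - 288 * k ^+ 2) *: a.
  rewrite p0 !vprodE !mulT; apply: form_ext => z.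
  by rewrite -/k -/y !formE; field.
have H01 : pair_part0 a x ** pair_part1 a x = (- 4) *: (s ** s)
    + (17 / 32 + 12 * k) *: s + (7 / 128) *: t
    + (75 / 8 * k - 39 / 2048) *: (x + y) + (21 / 2048) *: (x' + y')
    + (45 / 1024 - 21 / 4 * k + 288 * k ^+ 2) *: a.
  rewrite p0 p1 !vprodE !mulT; apply: form_ext => z.
  by rewrite -/k -/y !formE; field.
have H0 := fusion_00 Ha w0; have H1 := fusion_0half Ha w0 w1.
move: H0 H1; rewrite H00 H01 !vprodE !mulT sigma_reflect_mul => H0 H1.
apply: form_ext => z; have := congr1 (B ^~ z) H0; have := congr1 (B ^~ z) H1.
rewrite -/k -/y !formE => {}H1 {}H0; clear H00 H01.
lra.
Qed.

End Resurrection.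

Lemma reflect_sigma c u v : axis c -> G u -> G v ->
  refl c (sigma_vec u v) = sigma_vec (refl c u) (refl c v).
Proof.
move=> Hc Gu Gv; rewrite [RHS]/sigma_vec -lock -reflect_prod// sigmaE.
by rewrite !griess_reflectD griess_reflectZ griess_reflectD addrK.
Qed.

(** Moving a_(1) across the form replaces a.a_2 by a.b, whose pairing with a_2 is known because
    [sigma_vec a b] is fixed by the reflection at b. *)
Lemma form_sigma_opp a b : axis a -> axis b -> B (sigma_vec a (refl b a)) b =
  15 / 8 * B a b + 1 / 16 * B a (refl b a) - 1 / 64.
Proof.
move=> Ha Hb; have Ga := axis_homog Ha; have Gb := axis_homog Hb.
have Ga' : G (refl b a) by exact: reflect_homog.
have Gs : G (sigma_vec a b) by exact: sigma_homog.
rewrite {1}/sigma_vec -lock !formE griess_assoc// sigmaE !formE.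
rewrite (form_sym Ga' Gs) [sigma_vec a b]sigmaC// form_sigma_reflect//.
rewrite -(sigmaC Ga Gb) (form_sym Gs Ga) form_sigmal//.
rewrite (form_sym Ga' Gb) (form_sym Ga' Ga) form_reflect// (form_sym Gb Ga).
by field.
Qed.

(* In terms of the sequence a_0 = a, a_1 = b, a_(2i-j) = reflection of a_j in
   a_i, the vectors are a_-1, a_2, a_-2 and a_3. *)
Theorem axis_pair_relations a b : axis a -> axis b ->
  let am1 := refl a b in let a2 := refl b a in
  let am2 := refl a a2 in let a3 := refl b am1 in
  let l1 := B a b in let l2 := B a a2 in let l3 := B am1 a2 in
  let l4 := B am2 a2 in let l5 := B am2 a3 in
  let K := 33 - 9 * (1024 * l1) + 512 * l2 + 1 / 2 * (1024 * l1) ^+ 2 in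
  [/\ B b am1 = l2, B am1 a3 = l4,
      210 * (l1 - l2) + (7 * (1024 * l1) - 42) * (l1 - l2) + 7 * (l2 - l3)
        + K * (1 / 4 - l1) = 0,
      210 * (l1 - l2) + (7 * (1024 * l1) - 42) * (l3 - 1 / 4) + 7 * (l4 - l1)
        + K * (l2 - l1) = 0 &
      - (210 * (l1 - l2)) + (7 * (1024 * l1) - 42) * (l4 - l1) + 7 * (l5 - 1 / 4)
        + K * (l3 - l2) = 0].
Proof.
move=> Ha Hb am1 a2 am2 a3 l1 l2 l3 l4 l5 K.
have Ga := axis_homog Ha; have Gb := axis_homog Hb.
have Hm1 : axis am1 by exact: reflect_axis.
have H2 : axis a2 by exact: reflect_axis.
have Hm2 : axis am2 by exact: reflect_axis.
have H3 : axis a3 by exact: reflect_axis.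
have Gm1 := axis_homog Hm1; have G2 := axis_homog H2.
have Gm2 := axis_homog Hm2; have G3 := axis_homog H3.
have raa : refl a a = a by exact: reflect_self.
have rbb : refl b b = b by exact: reflect_self.
have ram1 : refl a am1 = b by exact: reflectK.
have ram2 : refl a am2 = a2 by exact: reflectK.
have rb2 : refl b a2 = a by exact: reflectK.
have rb3 : refl b a3 = am1 by exact: reflectK.
have fa u v : G u -> G v -> B (refl a u) (refl a v) = B u v by exact: reflect_form.
have fb u v : G u -> G v -> B (refl b u) (refl b v) = B u v by exact: reflect_form.
have l2E : B b am1 = B a a2.
  have := sigma_form Hb Ha; rewrite -sigmaC// sigma_form// (form_sym Gb Ga) => ?.
  lra.
set s2 := sigma_vec a a2; set t := sigma_vec b am1.
(* The expressions of s^2 obtained around a and around b agree. *)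
have rel : (49 / 384) *: (t - s2) + (49 / 6 * l1 - 49 / 1024) *: (am1 - a2)
    + (49 / 6144) *: (am2 - a3) + (7 / 6144 * K) *: (a - b) = 0.
  have := sigma_square Hb Ha; rewrite -sigmaC// sigma_square// => H.
  apply: form_ext => z; have := congr1 (B ^~ z) H.
  rewrite -/am1 -/a2 -/am2 -/a3 -/s2 -/t l2E (form_sym Gb Ga) -/l1 -/l2 /K !formE => {}H.
  lra.
have s2a : B s2 a = 31 / 16 * l2 - 1 / 64.
  by rewrite form_sym ?form_sigmal//; exact: sigma_homog.
have s22 : B s2 a2 = 31 / 16 * l2 - 1 / 64.
  by rewrite form_sym ?form_sigmar//; exact: sigma_homog.
have Gs2 : G s2 by exact: sigma_homog.
have Gt : G t by exact: sigma_homog.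
have s2b : B s2 b = 15 / 8 * l1 + 1 / 16 * l2 - 1 / 64 by exact: form_sigma_opp.
have ras2 : refl a s2 = s2 by exact: sigma_reflect.
have rbs2 : refl b s2 = s2 by rewrite reflect_sigma// rb2 -/a2 sigmaC.
have rat : refl a t = t by rewrite reflect_sigma// ram1 -/am1 sigmaC.
have rbt : refl b t = t by exact: sigma_reflect.
have s2m1 : B s2 am1 = B s2 b by rewrite -{1}ras2 fa.
have s23 : B s2 a3 = B s2 am1 by rewrite -{1}rbs2 fb.
have tb : B t b = 31 / 16 * l2 - 1 / 64.
  by rewrite form_sym ?form_sigmal ?l2E//; exact: sigma_homog.
have tm1 : B t am1 = 31 / 16 * l2 - 1 / 64 by rewrite -tb -{1}rat fa.
have t3 : B t a3 = B t am1 by rewrite -{1}rbt fb.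
have ta : B t a = 15 / 8 * l1 + 1 / 16 * l2 - 1 / 64.
  by rewrite form_sigma_opp// l2E (form_sym Gb Ga).
have t2 : B t a2 = B t a by rewrite -{1}rbt fb.
have am1a : B am1 a = l1 by rewrite -{1}raa fa// form_sym.
have am2a : B am2 a = l2 by rewrite -{1}raa fa// form_sym.
have a3a : B a3 a = l3 by rewrite -{1}rb2 fb.
have a2a : B a2 a = l2 by rewrite form_sym.
have ba : B b a = l1 by rewrite form_sym.
have a2m1 : B a2 am1 = l3 by rewrite form_sym.
have am2m1 : B am2 am1 = l1.
  have -> : B am2 am1 = B a2 b by rewrite fa.
  by rewrite -{1}rbb fb// form_sym.
have a3m1 : B a3 am1 = B am1 a3 by rewrite form_sym.
have bm1 : B b am1 = l2 by [].
have b2 : B b a2 = l1 by rewrite form_sym// -{1}rbb fb.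
have a32 : B a3 a2 = l1 by rewrite fb.
have b3 : B b a3 = l2 by rewrite -{1}rbb fb.
have a3' : B a a3 = l3 by rewrite form_sym.
have a23 : B a2 a3 = l1 by rewrite form_sym.
(* Here 7/6144 [K] is the coefficient of a in the expression around a minus its coefficient in the
   one around b. The stated relations are these pairings times 6144/7; 210 is 112 times 15/8. *)
have pair u : 49 / 384 * (B t u - B s2 u)
    + (49 / 6 * l1 - 49 / 1024) * (B am1 u - B a2 u)
    + 49 / 6144 * (B am2 u - B a3 u) + 7 / 6144 * K * (B a u - B b u) = 0.
  by have := congr1 (B ^~ u) rel; rewrite !formE.
have am1E := axis_form Hm1; have a2E := axis_form H2; have a3E := axis_form H3.
have aE := axis_form Ha.
have P0 := pair a; have Pm1 := pair am1; have P2 := pair a2; have P3 := pair a3.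
rewrite ta s2a am1a a2a am2a a3a aE ba in P0.
rewrite tm1 s2m1 s2b am1E a2m1 am2m1 a3m1 (form_sym Ga Gm1) am1a bm1 in Pm1.
rewrite t2 ta s22 -/l3 a2E -/l4 a32 -/l2 b2 in P2.
rewrite t3 tm1 s23 s2m1 s2b a23 -/l5 a3E a3' b3 in P3.
(* Exchanging a and b negates [rel] and swaps a_-1 with a_2; in the sum of the two pairings only the
   multiple 49/6144 of (a_-2, a_2) - (a_-1, a_3) is left. *)
have l4E : B am1 a3 = l4 by clear -Pm1 P2; lra.
rewrite l4E in P3; split=> //; [clear -P0|clear -P2|clear -P3]; lra.
Qed.

End Griess.

(** * Dihedral sequences *)

(** The two reflections generate the translation by 2, so 0 and 1 represent their orbits on the
    integers. *)
Lemma dihedral_ind (P : int -> Prop) : P 0 -> P 1 ->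
  (forall i, P i -> P (- i)) -> (forall i, P i -> P (2 - i)) -> forall i, P i.
Proof.
move=> P0 P1 PN P2; have PS i : P i -> P (i + 2).
  by move=> /PN/P2; rewrite opprK addrC.
have Pnat (n : nat) : P n%:Z /\ P n.+1%:Z.
  elim: n => // n [IH1 IH2]; split=> //.
  by rewrite (_ : n.+2%:Z = n%:Z + 2); [exact: PS|lia].
case=> n; first by case: (Pnat n).
by rewrite NegzE; apply: PN; case: (Pnat n).
Qed.

Lemma mulz_small (c d : int) (p : nat) :
  d = c * p%:Z -> - p%:Z < d -> d < p%:Z -> d = 0.
Proof.
move=> -> d1 d2; have [c1|[->|c1]] : c <= -1 \/ c = 0 \/ 1 <= c by lia.
- nia.
- by rewrite mul0r.
- nia.
Qed.

(** * The minimal period of a dihedral sequence *)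

Section PeriodicSequence.
Variables (T : Type) (a : int -> T) (N : nat).
Hypothesis aN : forall i j, a i = a j -> a (- i) = a (- j).
Hypothesis a2 : forall i j, a i = a j -> a (2 - i) = a (2 - j).
Hypothesis a_refl : forall i j k : int, a i = a j -> a (2 * i - k) = a (2 * j - k).
Hypothesis a_step2 : forall i, a i = a (i + 2) -> a (i + 1) = a (i + 3).
Hypothesis a_step4 : forall i, a i = a (i + 4) -> a (i + 1) = a (i + 5).
Hypothesis cardN : (range a #= `I_N)%card.
Hypothesis N_le6 : (N <= 6)%N.

Let period (d : int) := forall k : int, a (k + d) = a k.

Let inj_bound (g : nat -> T) m : (forall n, range a (g n)) ->
  (forall i j, (i < m)%N -> (j < m)%N -> g i = g j -> i = j) -> (m <= N)%N.
Proof.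
move=> ga ginj; rewrite -card_le_II -(card_le_eqr cardN).
have /card_eqPle[_ le1] : (g @` `I_m #= `I_m)%card.
  by apply: inj_card_eq => i j /[!inE]; exact: ginj.
apply: (card_le_trans le1); apply: subset_card_le => _ [n _ <-]; exact: ga.
Qed.

Let periodN d : period d -> period (- d).
Proof. by move=> pd k; have := pd (k - d); rewrite subrK. Qed.

Let periodD d d' : period d -> period d' -> period (d + d').
Proof. by move=> pd pd' k; rewrite addrA pd' pd. Qed.

Let periodM (n : nat) d : period d -> period (n%:Z * d).
Proof.
move=> pd; elim: n => [|n IH k]; first by move=> k; rewrite mul0r addr0.
by rewrite (_ : n.+1%:Z * d = n%:Z * d + d); [exact: periodD|lia].
Qed.

Let periodMz c d : period d -> period (c * d).
Proof.
move=> pd; case: c => n; first exact: periodM.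
by rewrite NegzE mulNr; apply/periodN/periodM.
Qed.

(** Equal terms define equal reflections, and the reflections of indices at i and j compose to the
    translation by 2(j - i). *)
Let eq_period i j : a i = a j -> period (2 * (j - i)).
Proof.
move=> /a_refl aij k; have := aij (2 * i - k).
by rewrite subKr => ->; congr a; lia.
Qed.

Let exists_period : exists p, (0 < p)%N && `[< period p%:Z >].
Proof.
have [inj|/existsNP[i /existsNP[j]]] := pselect (forall i j : nat, a i = a j -> i = j).
  suff : (N.+1 <= N)%N by rewrite ltnn.
  apply: (@inj_bound (fun n : nat => a n)) => [n|i j _ _]; last exact: inj.
  by exists n%:Z.
move=> /not_implyP[aij ij]; exists (2 * `|j%:Z - i%:Z|)%N.
apply/andP; split; first by lia.
apply/asboolP; have pij := eq_period aij; have [ij'|ij'] := leP i j.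
  by rewrite (_ : (_ * _)%N%:Z = 2 * (j%:Z - i%:Z)) //; lia.
by rewrite (_ : (_ * _)%N%:Z = - (2 * (j%:Z - i%:Z))); [exact: periodN|lia].
Qed.

(* For an even minimal period p = 2q, a_i = a_(i+q) might hold for one parity of
   i only: [a_step2] and [a_step4] exclude this for q = 2 and q = 4, and for
   q >= 6 there would be more than six elements. *)
Lemma dihedral_period : period N%:Z /\ forall i j, a i = a j -> (N%:Z %| i - j)%Z.
Proof.
case: (ex_minnP exists_period) => p /andP[p0 /asboolP pp] pmin.
have pdvd d : period d -> (p%:Z %| d)%Z.
  move=> pd; have pr : period (d %% p%:Z)%Z.
    rewrite -[(_ %% _)%Z](addrK ((d %/ p%:Z)%Z * p%:Z)) [_ + _ * _]addrC -divz_eq.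
    by apply: periodD => //; apply/periodN/periodMz.
  apply/dvdz_mod0P/eqP; apply: contraT => r0.
  have r1 : 0 <= (d %% p%:Z)%Z by apply: modz_ge0; lia.
  have r2 : (d %% p%:Z)%Z < p%:Z by apply: ltz_pmod; lia.
  have := pmin `|(d %% p%:Z)%Z|%N; rewrite gez0_abs//.
  have -> : `[< period (d %% p%:Z)%Z >] by apply/asboolP.
  rewrite andbT => /(_ _); lia.
suff inj i j : a i = a j -> (p%:Z %| i - j)%Z.
  suff -> : N = p by [].
  apply/card_eq_II; rewrite -(card_eql cardN) (_ : range a = (fun n : nat => a n) @` `I_p).
    apply: inj_card_eq => m n /[!inE] /= mp np /inj /dvdzP[c] /mulz_small; lia.
  apply/seteqP; split=> _ [k _ <-]; last by exists k%:Z.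
  exists `|(k %% p%:Z)%Z|%N => /=.
    have : (k %% p%:Z)%Z < p%:Z by apply: ltz_pmod; lia.
    have : 0 <= (k %% p%:Z)%Z by apply: modz_ge0; lia.
    lia.
  rewrite gez0_abs; last by apply: modz_ge0; lia.
  by rewrite [in RHS](divz_eq k p%:Z) addrC (periodMz _ pp).
have dvd2 u v : a u = a v -> exists c, 2 * (v - u) = c * p%:Z.
  by move=> /eq_period/pdvd/dvdzP.
have [q [pq|pq]] : exists q : nat, p = (2 * q)%N \/ p = (2 * q + 1)%N.
  by exists (p %/ 2)%N; lia.
- have [[u su]|nosym] := pselect (exists u, a u = a (u + q%:Z)); last first.
    move=> aij; have [c hc] := dvd2 _ _ aij.
    have hc' : j - i = c * q%:Z by nia.
    (* Without a half-period coincidence c is even: an odd c would give a_i = a_(i+q). *)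
    have [d [hd|hd]] : exists d : int, c = 2 * d \/ c = 2 * d + 1.
      by exists (c %/ 2)%Z; lia.
      by apply/dvdzP; exists (- d); nia.
    case: nosym; exists i; rewrite aij -(periodMz d pp (i + q%:Z)); congr a; nia.
  have q0 : (0 < q)%N by lia.
  (* The reflections at 0 and 1 carry a coincidence at k to k + 2, hence to the whole parity class.
     It cannot hold in the other class too, for q would then be a period below the minimum p. *)
  have step (k : int) (n : nat) : a k = a (k + q%:Z) ->
      a (k + 2 * n%:Z) = a (k + 2 * n%:Z + q%:Z).
    move=> sk; elim: n => [|n IH]; first by rewrite mulr0 addr0.
    have := a2 (aN IH); rewrite (_ : 2 - - _ = k + 2 * n.+1%:Z); last by lia.
    by move=> ->; congr a; lia.
  have stepz (k l : int) : a k = a (k + q%:Z) -> a (k + 2 * l) = a (k + 2 * l + q%:Z).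
    move=> sk; pose m := `|l|%N; have lm : 0 <= l + m%:Z * p%:Z by nia.
    have := step k `|(l + m%:Z * p%:Z)%R|%N sk; rewrite gez0_abs//.
    rewrite (_ : k + 2 * (l + m%:Z * p%:Z) = k + 2 * l + (2 * m%:Z) * p%:Z); last by ring.
    by rewrite [_ + q%:Z]addrAC !(periodMz _ pp).
  have not_all : ~ forall k, a k = a (k + q%:Z).
    move=> Sall; have : period q%:Z by move=> k; rewrite -Sall.
    by move=> pq'; have := pmin q; rewrite q0 /=; move/asboolP: pq' => -> /(_ isT); lia.
  have nS : a (u + 1) <> a (u + 1 + q%:Z).
    move=> Su1; apply: not_all => k.
    have [d [hd|hd]] : exists d : int, k = u + 2 * d \/ k = u + 1 + 2 * d.
      by exists ((k - u) %/ 2)%Z; lia.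
    + by rewrite hd; exact: stepz.
    + by rewrite hd; exact: stepz.
  have [r [qr|qr]] : exists r : nat, q = (2 * r)%N \/ q = (2 * r + 1)%N.
      by exists (q %/ 2)%N; lia.
  + have [q6|q6] := ltnP q 6.
      have [r1|r2] : r = 1%N \/ r = 2%N by lia.
      * case: nS; rewrite qr r1; have := @a_step2 u.
        by rewrite -[u + 1 + _]addrA => -> //; rewrite su qr r1.
      * case: nS; rewrite qr r2; have := @a_step4 u.
        by rewrite -[u + 1 + _]addrA => -> //; rewrite su qr r2.
    (* For q at least 6, the six consecutive terms from u + 1 on and the term at u + 1 + q are
       distinct: an equality forces a difference of indices divisible by q, and the only such pair
       is excluded by [nS]. *)
    pose g n := if (n < 6)%N then a (u + 1 + n%:Z) else a (u + 1 + q%:Z).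
    have key (m n : nat) : (m < n < 7)%N -> g m = g n -> False.
      move=> /andP[mn n7]; rewrite /g (_ : (m < 6)%N = true); last by lia.
      case: ifP => n6 /[dup] E /dvd2[c hc].
        have /mulz_small : n%:Z - m%:Z = c * q%:Z by nia.
        lia.
      have hc' : q%:Z - m%:Z = c * q%:Z by nia.
      have m0 : m = 0%N.
        have [c1|c2] : c <= 0 \/ 1 <= c by lia.
          nia.
        nia.
      by apply: nS; rewrite m0 addr0 in E.
    suff : (7 <= N)%N by lia.
    apply: (@inj_bound g) => [n|m n m7 n7 gmn]; first by rewrite /g; case: ifP => _; eexists.
    have [mn|mn|//] := ltngtP m n.
    * by case: (key m n) => //; rewrite mn n7.
    * by case: (key n m) => //; rewrite mn m7.
  (* For odd q, negation turns the coincidence at u into one at -u - q, which has the other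
     parity. *)
  + exfalso; apply: nS; have := aN su => H.
    have {}H : a (- u - q%:Z) = a (- u - q%:Z + q%:Z) by rewrite subrK H; congr a; lia.
    have := stepz _ (u + r%:Z + 1) H.
    by rewrite (_ : - u - q%:Z + 2 * (u + r%:Z + 1) = u + 1); [|lia].
(* With p = 2q + 1, c = 2(j - i - qc) is even, and the witness is -c/2. *)
- move=> /dvd2[c hc]; apply/dvdzP; exists (- (j - i - q%:Z * c)); nia.
Qed.

End PeriodicSequence.

(** * Construction of the sequence from two involutions *)

Section DihedralSequence.
Variables (T : Type) (G : T -> Prop) (s t : T -> T) (e f : T).
Hypotheses (Ge : G e) (Gf : G f).
Hypotheses (Gs : forall x, G x -> G (s x)) (Gt : forall x, G x -> G (t x)).
Hypotheses (sK : forall x, G x -> s (s x) = x) (tK : forall x, G x -> t (t x) = x).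
Hypotheses (se : s e = e) (tf : t f = f).

(** The k-th power of ts. The inverse powers are written with st, which inverts ts only on [G],
    where s and t are known to be involutions. *)
Let z (k : int) x :=
  match k with Posz n => iter n (t \o s) x | Negz n => iter n.+1 (s \o t) x end.

Let zG k x : G x -> G (z k x).
Proof.
by case: k => n Gx; elim: n => [|n IH] /=; [|exact/Gt/Gs|exact/Gs/Gt|exact/Gs/Gt].
Qed.

Let zS k x : G x -> z (k + 1) x = t (s (z k x)).
Proof.
case: k => n Gx; first by rewrite -PoszD addn1.
case: n => [|n]; first by rewrite /= sK ?tK//; exact: Gt.
rewrite (_ : Negz n.+1 + 1 = Negz n); last by rewrite !NegzE; lia.
by rewrite /= sK ?tK//; do ?[exact: Gt|exact/Gs/Gt|exact: (@zG (Negz n))|exact/Gt/(@zG (Negz n))].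
Qed.

Let zP k x : G x -> z (k - 1) x = s (t (z k x)).
Proof.
move=> Gx; rewrite -[in RHS](subrK 1 k) zS//; have := zG (k - 1) Gx => H.
by rewrite tK ?sK//; exact: Gs.
Qed.

Let zs k x : G x -> s (z k x) = z (- k) (s x).
Proof.
move=> Gx; elim/int_ind: k => [//|n IH|n IH].
- rewrite -addn1 PoszD zS// opprD zP; last exact: Gs.
  by rewrite -IH.
- rewrite opprK in IH; rewrite -addn1 PoszD opprD zP// opprD !opprK zS; last exact: Gs.
  by rewrite -IH !sK//; [exact: zG|exact/Gt/zG].
Qed.

Let zt k x : G x -> t (z k x) = z (- k) (t x).
Proof.
move=> Gx; elim/int_ind: k => [//|n IH|n IH].
- rewrite -addn1 PoszD zS// opprD zP; last exact: Gt.
  by rewrite -IH !tK//; [exact: zG|exact/Gs/zG].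
- rewrite opprK in IH; rewrite -addn1 PoszD opprD zP// opprD !opprK zS; last exact: Gt.
  by rewrite -IH.
Qed.

Lemma dihedral_sequence : exists a : int -> T,
  [/\ a 0 = e, a 1 = f, forall i, s (a i) = a (- i), forall i, t (a i) = a (2 - i)
    & forall i, G (a i)].
Proof.
pose a i := z (i %/ 2)%Z (if (i %% 2)%Z == 0 then e else f).
have d0 (k : int) : ((2 * k) %/ 2)%Z = k by lia.
have d1 (k : int) : ((2 * k + 1) %/ 2)%Z = k by lia.
have r0 (k : int) : ((2 * k) %% 2)%Z = 0 by lia.
have r1 (k : int) : ((2 * k + 1) %% 2)%Z = 1 by lia.
have a0 k : a (2 * k) = z k e by rewrite /a d0 r0.
have a1 k : a (2 * k + 1) = z k f by rewrite /a d1 r1.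
have split i : exists k : int, i = 2 * k \/ i = 2 * k + 1.
  by exists (i %/ 2)%Z; lia.
exists a; split=> // i.
- have [k [->|->]] := split i.
    by rewrite a0 zs// se -a0 mulrN.
  rewrite (_ : - (2 * k + 1) = 2 * (- k - 1) + 1); last by lia.
  by rewrite !a1 zP// zt// tf opprK.
- have [k [->|->]] := split i.
    rewrite (_ : 2 - 2 * k = 2 * (- k + 1)); last by lia.
    by rewrite !a0 zS// zs// se opprK.
  rewrite a1 zt// tf (_ : 2 - (2 * k + 1) = 2 * (- k) + 1); last by lia.
  by rewrite a1.
- by rewrite /a; case: ifP => _; exact: zG.
Qed.

End DihedralSequence.

(** * The relations along a periodic sequence of axes *)

Section AxisSequence.
Variables (R : realType) (V : voa R) (B : V -> V -> R).
Hypotheses (HV : standing_grading V) (HB : invariant_form B).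
Hypotheses (HB1 : B (vac V) (vac V) = 1) (HBpos : positive_definite B).
Variable a : int -> V.
Hypothesis a_axis : forall i, axis (a i).
Hypothesis a_refl : forall i j, griess_reflect (a i) (a j) = a (2 * i - j).

Let a_form i : B (a i) (a i) = 1 / 4.
Proof. by apply: (axis_form HV HB HB1). Qed.

Let Ga i : homog 2 (a i).
Proof. exact: axis_homog. Qed.

Let form_symm i j : B (a i) (a j) = B (a j) (a i).
Proof. by apply: (form_sym HV HB HB1). Qed.

Let form_eq i j : B (a i) (a j) = 1 / 4 -> a i = a j.
Proof.
move=> aij; apply/eqP; rewrite -subr_eq0; apply/eqP/(form_eq0 HBpos).
by rewrite !(formE HB) [B (a j) (a i)]form_symm aij !a_form; ring.
Qed.

Let form_refl i j k : B (a (2 * k - i)) (a (2 * k - j)) = B (a i) (a j).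
Proof. by rewrite -!a_refl; apply: (reflect_form HV HB HB1). Qed.

Let form_opp i j : B (a (- i)) (a (- j)) = B (a i) (a j).
Proof. by rewrite -(form_refl i j 0) mulr0 !sub0r. Qed.

Let form_opp2 i j : B (a (2 - i)) (a (2 - j)) = B (a i) (a j).
Proof. by rewrite -(form_refl i j 1) mulr1. Qed.

(** The pair a_i, a_(i+d) generates the subsequence of step d; steps 2 and 3 reduce parts of the
    cases N = 4 and N = 6 to two or three axes. *)
Let relations (i d : int) :
  let l1 := B (a i) (a (i + d)) in let l2 := B (a i) (a (i + 2 * d)) in
  let l3 := B (a (i - d)) (a (i + 2 * d)) in
  let l4 := B (a (i - 2 * d)) (a (i + 2 * d)) in
  let l5 := B (a (i - 2 * d)) (a (i + 3 * d)) in
  let K := 33 - 9 * (1024 * l1) + 512 * l2 + 1 / 2 * (1024 * l1) ^+ 2 in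
  [/\ B (a (i + d)) (a (i - d)) = l2, B (a (i - d)) (a (i + 3 * d)) = l4,
      210 * (l1 - l2) + (7 * (1024 * l1) - 42) * (l1 - l2) + 7 * (l2 - l3)
        + K * (1 / 4 - l1) = 0,
      210 * (l1 - l2) + (7 * (1024 * l1) - 42) * (l3 - 1 / 4) + 7 * (l4 - l1)
        + K * (l2 - l1) = 0 &
      - (210 * (l1 - l2)) + (7 * (1024 * l1) - 42) * (l4 - l1) + 7 * (l5 - 1 / 4)
        + K * (l3 - l2) = 0].
Proof.
have := axis_pair_relations HV HB HB1 HBpos (a_axis i) (a_axis (i + d)).
cbv zeta; rewrite !a_refl (_ : 2 * i - (i + d) = i - d); last by lia.
rewrite (_ : 2 * (i + d) - i = i + 2 * d); last by lia.
rewrite (_ : 2 * i - (i + 2 * d) = i - 2 * d); last by lia.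
by rewrite (_ : 2 * (i + d) - (i - d) = i + 3 * d); last by lia.
Qed.

(** By [relations], (a_(i+1), a_(i-1)) = (a_i, a_(i+2)) = 1/4, and vectors of square norm 1/4 with
    this inner product coincide by positivity. *)
Lemma sequence_step2 i : a i = a (i + 2) -> a (i + 1) = a (i + 3).
Proof.
move=> ai; have [+ _ _ _ _] := relations i 1; rewrite mulr1 -ai a_form.
move=> /form_eq H; have := a_refl (i + 1) (i - 1).
rewrite -H a_refl (_ : 2 * (i + 1) - (i + 1) = i + 1); last by lia.
by move=> ->; congr a; lia.
Qed.

Lemma sequence_step4 i : a i = a (i + 4) -> a (i + 1) = a (i + 5).
Proof.
move=> ai; have [_ + _ _ _] := relations (i + 2) 1.
rewrite (_ : i + 2 - 1 = i + 1); last by lia.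
rewrite (_ : i + 2 + 3 * 1 = i + 5); last by lia.
rewrite (_ : i + 2 - 2 * 1 = i); last by lia.
rewrite (_ : i + 2 + 2 * 1 = i + 4); last by lia.
by rewrite -ai a_form => /form_eq.
Qed.

Let adjacent i : B (a i) (a (i + 1)) = B (a 0) (a 1) /\
                 B (a i) (a (i - 1)) = B (a 0) (a 1).
Proof.
elim/dihedral_ind: i => [||i [H1 H2]|i [H1 H2]].
- by rewrite add0r sub0r -(form_opp 0 1) oppr0.
- by rewrite subrr -(form_opp2 1 (1 + 1)) form_symm.
- by rewrite -{1}H2 -H1 -(form_opp i (i - 1)) -(form_opp i (i + 1)) !opprD opprK.
- rewrite -{1}H2 -H1 -(form_opp2 i (i - 1)) -(form_opp2 i (i + 1)).
  by rewrite !opprD opprK !addrA.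
Qed.

(** The induction stays within one parity class; the base case at 1 needs the equality (a_1, a_-1) =
    (a_0, a_2) from [relations]. *)
Let second i : B (a i) (a (i + 2)) = B (a 0) (a 2) /\
               B (a i) (a (i - 2)) = B (a 0) (a 2).
Proof.
elim/dihedral_ind: i => [||i [H1 H2]|i [H1 H2]].
- by rewrite add0r sub0r -(form_opp 0 2) oppr0.
- have [+ _ _ _ _] := relations 0 1; rewrite !add0r mulr1 => <-.
  by rewrite -(form_opp2 1 (1 + 2)).
- by rewrite -{1}H2 -H1 -(form_opp i (i - 2)) -(form_opp i (i + 2)) !opprD opprK.
- rewrite -{1}H2 -H1 -(form_opp2 i (i - 2)) -(form_opp2 i (i + 2)).
  by rewrite !opprD opprK !addrA.
Qed.

Variable N : nat.
Hypothesis periodN : forall k, a (k + N%:Z) = a k.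
Hypothesis a_inj : forall i j, a i = a j -> (N%:Z %| i - j)%Z.

Let form_neq i j : ~~ (N%:Z %| i - j)%Z -> B (a i) (a j) - 1 / 4 != 0.
Proof. by apply: contraNneq => /subr0_eq/form_eq/a_inj. Qed.

Let two_axes i d : a (i + 2 * d) = a i -> a (i - d) = a (i + d) ->
  B (a i) (a (i + d)) - 1 / 4 != 0 ->
  B (a i) (a (i + d)) = 0 \/ B (a i) (a (i + d)) = 1 / 32.
Proof.
move=> a2 a1; have [_ _ + _ _] := relations i d.
rewrite a2 a1 a_form [B (a (i + d)) _]form_symm; move: (B _ _) => l H l4.
(* With l2 = 1/4 and l3 = l1 the first relation is 16384 times this product. *)
have : (l - 1 / 4) * (l * (1 - 32 * l)) = 0 by lra.
move/eqP; rewrite mulf_eq0 (negbTE l4) mulf_eq0 => /= /orP[/eqP|/eqP H']; first by left.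
right; lra.
Qed.

Let three_axes i d : a (i + 2 * d) = a (i - d) -> 
  B (a i) (a (i + d)) - 1 / 4 != 0 ->
  B (a i) (a (i + d)) = 13 / 1024 \/ B (a i) (a (i + d)) = 1 / 256.
Proof.
move=> a2; have [_ _ + _ _] := relations i d.
have -> : B (a i) (a (i + 2 * d)) = B (a i) (a (i + d)).
  by rewrite a2 -(form_refl i (i + d) i); congr (B (a _) (a _)); lia.
rewrite a2 a_form; move: (B _ _) => l H l4.
have : (l - 1 / 4) * ((1024 * l - 4) * (1024 * l - 13)) = 0 by lra.
move/eqP; rewrite mulf_eq0 (negbTE l4) mulf_eq0 => /= /orP[/eqP ?|/eqP ?]; [right|left]; lra.
Qed.

Let l1 := B (a 0) (a 1).
Let l2 := B (a 0) (a 2).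

Lemma sequence_N2 : N = 2%N -> l1 = 0 \/ l1 = 1 / 32.
Proof.
move=> N2; rewrite /l1 -[1]add0r; apply: two_axes.
- by rewrite -(periodN 0) N2.
- by rewrite -(periodN (0 - 1)) N2.
- by apply: form_neq; rewrite N2.
Qed.

Lemma sequence_N3 : N = 3%N -> l1 = 13 / 1024 \/ l1 = 1 / 256.
Proof.
move=> N3; rewrite /l1 -[1]add0r; apply: three_axes.
- by rewrite -(periodN (0 - 1)) N3.
- by apply: form_neq; rewrite N3.
Qed.

Lemma sequence_N4 : N = 4%N ->
  (l1 = 1 / 128 /\ l2 = 0) \/ (l1 = 1 / 256 /\ l2 = 1 / 32).
Proof.
move=> N4; have l2E : l2 = 0 \/ l2 = 1 / 32.
  rewrite /l2 -[2]add0r; apply: two_axes.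
  - by rewrite -(periodN 0) N4.
  - by rewrite -(periodN (0 - 2)) N4.
  - by apply: form_neq; rewrite N4.
have [_ _] := relations 0 1; rewrite -[B (a 0) (a (0 + 1))]/l1 -[B (a 0) (a (0 + 2 * 1))]/l2.
have -> : B (a (0 - 1)) (a (0 + 2 * 1)) = l1.
  rewrite -(periodN (0 - 1)) N4 (_ : a (0 + 2 * 1) = a (3 - 1))//.
  by case: (adjacent 3).
have -> : B (a (0 - 2 * 1)) (a (0 + 2 * 1)) = 1 / 4.
  by rewrite -(periodN (0 - 2 * 1)) N4 (_ : a (0 + 2 * 1) = a (0 - 2 * 1 + 4%N%:Z)).
(* The first two relations differ by 1/4 - l2 times a quadratic polynomial in l1; the first relation
   rejects one of its roots. *)
move: l1 l2 l2E => x y [->|->] H0 H1 _; [left|right]; split=> //.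
  have : (x - 1 / 128) * (x + 1 / 256) = 0 by lra.
  move/eqP; rewrite mulf_eq0 => /orP[/eqP ?|/eqP xE]; first by lra.
  have xE' : x = - (1 / 256) by lra.
  by move: H0; rewrite xE' => ?; lra.
have : x * (x - 1 / 256) = 0 by lra.
move/eqP; rewrite mulf_eq0 => /orP[/eqP xE|/eqP ?]; last by lra.
by move: H0; rewrite xE => ?; lra.
Qed.

Lemma sequence_N5 : N = 5%N -> l1 = 3 / 512 /\ l2 = 3 / 512.
Proof.
move=> N5; have [_ _] := relations 0 1.
rewrite -[B (a 0) (a (0 + 1))]/l1 -[B (a 0) (a (0 + 2 * 1))]/l2.
have -> : B (a (0 - 1)) (a (0 + 2 * 1)) = l2.
  rewrite -(periodN (0 - 1)) N5 (_ : a (0 + 2 * 1) = a (4 - 2))//.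
  by case: (second 4).
have -> : B (a (0 - 2 * 1)) (a (0 + 2 * 1)) = l1.
  rewrite -(periodN (0 - 2 * 1)) N5 (_ : a (0 + 2 * 1) = a (3 - 1))//.
  by case: (adjacent 3).
have -> : B (a (0 - 2 * 1)) (a (0 + 3 * 1)) = 1 / 4.
  by rewrite -(periodN (0 - 2 * 1)) N5 (_ : a (0 + 3 * 1) = a (0 - 2 * 1 + 5%N%:Z)).
have : l1 - 1 / 4 != 0 by apply: form_neq; rewrite N5.
(* The third relation collapses to 210 (l1 - l2) = 0, and then the second to (l1 - 1/4)(7168 l1 -
   42) = 0. *)
move: l1 l2 => x y x4 H0 H2 H3; have yx : y = x by lra.
suff xE : x = 3 / 512 by rewrite yx.
move: H2; rewrite yx => {}H2.
have : (x - 1 / 4) * (x - 3 / 512) = 0 by lra.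
by move/eqP; rewrite mulf_eq0 (negbTE x4) => /= /eqP ?; lra.
Qed.

Lemma sequence_N6 : N = 6%N ->
  [/\ l1 = 5 / 1024, l2 = 13 / 1024 & B (a (-1)) (a 2) = 1 / 32].
Proof.
move=> N6; have l2E : l2 = 13 / 1024 \/ l2 = 1 / 256.
  rewrite /l2 -[2]add0r; apply: three_axes.
  - by rewrite -(periodN (0 - 2)) N6.
  - by apply: form_neq; rewrite N6.
have l3E : B (a (-1)) (a (-1 + 3)) = 0 \/ B (a (-1)) (a (-1 + 3)) = 1 / 32.
  apply: two_axes.
  - by rewrite -(periodN (-1)) N6.
  - by rewrite -(periodN (-1 - 3)) N6.
  - by apply: form_neq; rewrite N6.
have [_ _] := relations 0 1.
rewrite -[B (a 0) (a (0 + 1))]/l1 -[B (a 0) (a (0 + 2 * 1))]/l2.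
rewrite (_ : 0 - 1 = -1)// (_ : 0 + 2 * 1 = 2)//.
have -> : B (a (0 - 2 * 1)) (a 2) = l2.
  rewrite -(periodN (0 - 2 * 1)) N6 (_ : a 2 = a (4 - 2))//.
  by case: (second 4).
have -> : B (a (0 - 2 * 1)) (a (0 + 3 * 1)) = l1.
  rewrite -(periodN (0 - 2 * 1)) N6 (_ : a (0 + 3 * 1) = a (4 - 1))//.
  by case: (adjacent 4).
have {l3E} : B (a (-1)) (a 2) = 0 \/ B (a (-1)) (a 2) = 1 / 32 by [].
move: (B (a (-1)) (a 2)) l1 l2 l2E => z x y [->|->] [->|->] H0 H2 H3.
(* The third relation is quadratic in 1024 l1. Here, and in the third case, it has no real root; the
   square is centred at its vertex. *)
- exfalso; have := sqr_ge0 (1024 * x - 47 / 27).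
  by lra.
- split=> //; have : (x - 5 / 1024) * (1024 * x - 457 / 5) = 0 by lra.
  move/eqP; rewrite mulf_eq0 => /orP[/eqP ?|/eqP xE]; first by lra.
  have {}xE : x = 457 / 5 / 1024 by lra.
  by move: H0; rewrite xE => ?; lra.
- exfalso; have := sqr_ge0 (1024 * x + 97 / 18).
  by lra.
(* Now the third relation has real roots. It and its multiple by x reduce the cubic first relation
   to a linear one, whose root -772/311 does not satisfy the quadratic. *)
- exfalso; have := congr1 ( *%R x) H3; rewrite mulr0 => H4.
  have xE : 1024 * x = - (772 / 311) by lra.
  have : (1024 * x) * (1024 * x) = - (772 / 311) * (1024 * x) by rewrite {1}xE.
  by lra.
Qed.

End AxisSequence.

(** The induction shows that each group element maps the range both into and onto itself; the
    surjectivity is what handles [Gen_inv]. *)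
Lemma orbit_union_range (R : realType) (V : voa R) (s t : V -> V) (a : int -> V) :
  (forall i, s (a i) = a (- i)) -> (forall i, t (a i) = a (2 - i)) ->
  let T := group_generated [set s; t] in
  orbit_of T (a 0) `|` orbit_of T (a 1) = range a.
Proof.
move=> sa ta T; have Ta g : T g -> (forall i, range a (g (a i))) /\
    (forall i, exists j, g (a j) = a i).
  elim=> {g} [g [->|->]||g h _ [g1 g2] _ [h1 h2]|g h _ [g1 g2] gh hg].
  - split=> i; first by rewrite sa; exists (- i).
    by exists (- i); rewrite sa opprK.
  - split=> i; first by rewrite ta; exists (2 - i).
    by exists (2 - i); rewrite ta subKr.
  - by split=> i; exists i.
  - split=> i /=; first by have [j _ <-] := h1 i; exact: g1.
    by have [j <-] := g2 i; have [k <-] := h2 j; exists k.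
  - split=> i; first by have [j <-] := g2 i; rewrite gh; exists j.
    by have [j _ gj] := g1 i; exists j; rewrite gj gh.
apply/seteqP; split=> [_ [[g /Ta[ga _] <-]|[g /Ta[ga _] <-]]|_ [i _ <-]] //.
elim/dihedral_ind: i => [||i [] [g Tg ga]|i [] [g Tg ga]].
- by left; exists id => //; exact: Gen_id.
- by right; exists id => //; exact: Gen_id.
- by left; exists (s \o g); [apply: Gen_comp => //; apply: Gen_mem; left|rewrite /= ga].
- by right; exists (s \o g); [apply: Gen_comp => //; apply: Gen_mem; left|rewrite /= ga].
- by left; exists (t \o g); [apply: Gen_comp => //; apply: Gen_mem; right|rewrite /= ga].
- by right; exists (t \o g); [apply: Gen_comp => //; apply: Gen_mem; right|rewrite /= ga].
Qed.

Theorem theorem4p4 (R : realType) (V : voa R) (B : V -> V -> R)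
    (HV : standing_grading V)
    (HB : invariant_form B) (HB1 : B (vac V) (vac V) = 1)
    (HBpos : positive_definite B)
    (e f : V) (He : ising_vector e) (Hf : ising_vector f)
    (te tf : V -> V) (Hte : is_tau e te) (Htf : is_tau f tf) :
  let T := group_generated [set te; tf] in
  let X := orbit_of T e `|` orbit_of T f in
  [/\ (X #= `I_2)%card -> B e f = 0 \/ B e f = 1 / 2 ^+ 5,
      (X #= `I_3)%card -> B e f = 13 / 2 ^+ 10 \/ B e f = 1 / 2 ^+ 8,
      (X #= `I_4)%card ->
        (B e f, B e (tf e)) = (1 / 2 ^+ 7, 0) \/
        (B e f, B e (tf e)) = (1 / 2 ^+ 8, 1 / 2 ^+ 5),
      (X #= `I_5)%card -> B e f = 3 / 2 ^+ 9 /\ B e (tf e) = 3 / 2 ^+ 9 &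
      (X #= `I_6)%card ->
        [/\ B e f = 5 / 2 ^+ 10,
            B e (tf e) = 13 / 2 ^+ 10 &
            B (tf e) (te f) = 1 / 2 ^+ 5]].
Proof.
move=> T X; have [He' _] := He; have [Hf' _] := Hf.
have [Aute _ _ _] := Hte; have [Autf _ _ _] := Htf.
have te_refl := tau_reflect HV HB HB1 HBpos He' Hte.
have tf_refl := tau_reflect HV HB HB1 HBpos Hf' Htf.
have axe : axis e by split=> //; exists te.
have axf : axis f by split=> //; exists tf.
have Ge := axis_homog axe; have Gf := axis_homog axf.
have Gte x : homog 2 x -> homog 2 (te x) by exact: automorphism_homog.
have Gtf x : homog 2 x -> homog 2 (tf x) by exact: automorphism_homog.
have teK x : homog 2 x -> te (te x) = x.
  by move=> Gx; rewrite !te_refl ?(reflectK HV HB HB1 HBpos)//; apply: reflect_homog.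
have tfK x : homog 2 x -> tf (tf x) = x.
  by move=> Gx; rewrite !tf_refl ?(reflectK HV HB HB1 HBpos)//; apply: reflect_homog.
have tee : te e = e by rewrite te_refl// (reflect_self HB HBpos).
have tff : tf f = f by rewrite tf_refl// (reflect_self HB HBpos).
have [a [a0 a1 tea tfa Ga]] := dihedral_sequence Ge Gf Gte Gtf teK tfK tee tff.
have a_axis i : axis (a i).
  elim/dihedral_ind: i => [||i|i]; rewrite ?a0 ?a1// -?tea -?tfa => ai.
    exact: automorphism_axis.
  exact: automorphism_axis.
(* Conjugation by tau_e or tau_f turns the reflection at a_i into that at a_(-i) or a_(2-i). *)
have a_refl i j : griess_reflect (a i) (a j) = a (2 * i - j).
  elim/dihedral_ind: i j => [j|j|i IH j|i IH j].
  - by rewrite a0 -te_refl// tea; congr a; lia.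
  - by rewrite a1 -tf_refl// tfa; congr a; lia.
  - rewrite -{1}(opprK j) -(tea i) -(tea (- j)) -automorphism_reflect// IH tea.
    by congr a; lia.
  - rewrite -{1}(subKr 2 j) -(tfa i) -(tfa (2 - j)) -automorphism_reflect// IH tfa.
    by congr a; lia.
have XE : X = range a by rewrite -(orbit_union_range tea tfa) a0 a1.
have main N : (N <= 6)%N -> (X #= `I_N)%card ->
    (forall k, a (k + N%:Z) = a k) /\ forall i j, a i = a j -> (N%:Z %| i - j)%Z.
  move=> N6; rewrite XE => cN; apply: dihedral_period => // [i j aij|i j aij|i j k aij|i|i].
  - by rewrite -!tea aij.
  - by rewrite -!tfa aij.
  - by rewrite -!a_refl aij.
  - exact: (sequence_step2 HV HB HB1 HBpos a_axis a_refl).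
  - exact: (sequence_step4 HV HB HB1 HBpos a_axis a_refl).
have tfe : tf e = a 2 by rewrite -a0 tfa subr0.
have tef : te f = a (-1) by rewrite -a1 tea.
rewrite tfe tef -a0 -a1; split=> /main[]// pN injN.
- have := sequence_N2 HV HB HB1 HBpos a_axis a_refl pN injN erefl.
  by case=> ->; [left|right; field].
- have := sequence_N3 HV HB HB1 HBpos a_axis a_refl pN injN erefl.
  by case=> ->; [left|right]; field.
- have := sequence_N4 HV HB HB1 HBpos a_axis a_refl pN injN erefl.
  by case=> -[-> ->]; [left|right]; congr (_, _); field.
- have := sequence_N5 HV HB HB1 HBpos a_axis a_refl pN injN erefl.
  by case=> -> ->; split; field.
- have [-> -> H] := sequence_N6 HV HB HB1 HBpos a_axis a_refl pN injN erefl.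
  rewrite (form_sym HV HB HB1 (Ga 2) (Ga (-1))) H; split; field; by [].
Qed.
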